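(* There exist absolute constants $C_1, C_2, C_3 > 0$ such that for every $\varepsilon > 0$ and every integer $n \ge 4$ with $n \ge C_1/\varepsilon$ there exist a real number $Q$ with $|Q| \le C_2 \sqrt{n}/\varepsilon$ and a time $t_0$ with $0 < t_0 < C_3\, n/\varepsilon$ such that, for the $n\times n$ matrix $H = A_{\text{path}} + Q\cdot D_{2,n-1}$ and $U(t) = e^{itH}$, one has $$|U(t_0)_{1,n}| > 1-\varepsilon,$$ i.e. there is quantum state transfer between the ends of the chain at time $t_0$ with fidelity at least $1-\varepsilon$.
   Context: $A_{\text{path}}$ is the adjacency matrix of the path graph on the nodes $1,2,\dots,n$ (entries $1$ at positions $(j,j+1)$ and $(j+1,j)$ for $1\le j\le n-1$, and $0$ elsewhere). $D_{2,n-1}$ is the $n\times n$ diagonal matrix whose diagonal entries in rows $2$ and $n-1$ are $1$ and whose other entries are $0$. The continuous time quantum walk of the system is $U(t) = e^{itH}$. If $|U(t_0)_{1,n}| > 1-\varepsilon$, one says that there is quantum state transfer between the ends of the chain at time $t_0$ with fidelity at least $1-\varepsilon$. *)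

(* Defs.v *)
From HB Require Import structures.
From mathcomp Require Import all_boot all_order all_algebra.
From mathcomp Require Import complex.
From mathcomp Require Import all_classical all_reals all_analysis.

Set Implicit Arguments.
Unset Strict Implicit.
Unset Printing Implicit Defensive.

Import Order.TTheory GRing.Theory Num.Theory.
Import numFieldNormedType.Exports.

Local Open Scope ring_scope.
Local Open Scope complex_scope.

(* Nodes 1, ..., n of the chain are encoded as 0, ..., n-1 in 'I_n; below,
   i.+1 is thus the mathematical label of i : 'I_n. *)

Definition path_adj (K : pzRingType) (n : nat) : 'M[K]_n :=
  \matrix_(i, j) ((j == i.+1 :> nat) || (i == j.+1 :> nat))%:R.

Definition potential_2_pred (K : pzRingType) (n : nat) : 'M[K]_n :=
  diag_mx (\row_j ((j.+1 == 2%N) || (j.+1 == n.-1))%:R).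

Definition chain_hamiltonian (R : realType) (n : nat) (Q : R) : 'M[R[i]]_n :=
  path_adj R[i] n + Q%:C *: potential_2_pred R[i] n.

(* The limit is taken in the normed space of matrices (max norm), where the
   exponential series always converges, so lim never takes its default value. *)
Definition expmx (K : numFieldType) (n : nat) (A : 'M[K]_n) : 'M[K]_n :=
  limn (series (fun k : nat => k`!%:R^-1 *: A ^+ k)).

Definition qwalk (R : realType) (n : nat) (H : 'M[R[i]]_n) (t : R) : 'M[R[i]]_n :=
  expmx (('i * t%:C) *: H).

Definition first_node (n : nat) (hn : (4 <= n)%N) : 'I_n :=
  Ordinal (leq_trans (isT : (0 < 4)%N) hn).

Definition last_node (n : nat) (hn : (4 <= n)%N) : 'I_n :=
  rev_ord (first_node hn).

(* Main.v *)
Require Import Defs.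
From HB Require Import structures.
From mathcomp Require Import all_boot all_order all_algebra.
From mathcomp Require Import complex.
From mathcomp Require Import all_classical all_reals all_analysis.
From mathcomp Require Import ring lra zify.

(* Put L = (n-3)/2 and measure positions from the middle of the chain.  In each
   parity sector an eigenvector of energy 2 sin (a + psi) is a sine wave on the
   nodes 2, ..., n-1, and the only condition left is a scalar equation in psi
   imposed by the two end nodes.  For Q = - 1 / (2 sin a) the end nodes have
   energy about 2 sin a; a is chosen so that this is exactly an energy of the
   symmetric standing wave on nodes 2, ..., n-1 with zeros at 2 and n-1.  The
   resonance splits the symmetric state of the two ends into two eigenvectors, at
   psi close to +b and -b with b^2 L = 2 a^2, while the antisymmetric state of the
   ends stays within o(b) of the resonance.  At the time t = 2 pi / (lam_+ - lam_-)
   the difference of the two symmetric eigenvectors is an eigenvector of U(t); it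
   nearly vanishes off the ends, and its phase is nearly opposite to that of the
   antisymmetric eigenvector.  All errors are O(a^2 L + 1/L), which is at most a
   small multiple of eps for a of order sqrt (eps/n); such resonances are spaced
   by a gap of order 1/n, hence the condition n >= C1/eps. *)

Set Implicit Arguments.
Unset Strict Implicit.
Unset Printing Implicit Defensive.

Import Order.TTheory GRing.Theory Num.Theory.
Import numFieldNormedType.Exports.

Local Open Scope ring_scope.
Local Open Scope complex_scope.

(** * The matrix exponential *)

Section Convergence.
Local Open Scope classical_set_scope.

Lemma cvg_mx (K : numFieldType) (m n : nat) (F : nat -> 'M[K]_(m, n))
    (M : 'M[K]_(m, n)) :
  (forall i j, (fun k => F k i j) @ \oo --> M i j) -> F @ \oo --> M.
Proof.
move=> FM; apply/cvg_ballP => e e0.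
have H : \forall k \near \oo, forall ij : 'I_m * 'I_n,
    ball (M ij.1 ij.2) e (F k ij.1 ij.2).
  apply: filter_forall => -[i j] /=.
  by have /cvg_ballP /(_ e e0) := FM i j.
near=> k; split=> // i j.
by have /(_ (i, j)) : forall ij : 'I_m * 'I_n, ball (M ij.1 ij.2) e (F k ij.1 ij.2)
  by near: k.
Unshelve. all: by end_near. Qed.

Definition cis (R : realType) (x : R) : R[i] := cos x +i* sin x.

(** The exponents are arranged so that the two parts match [cos_coeff] and [sin_coeff] term by
    term. *)
Lemma imagi_exp (R : realType) (k : nat) : ('i : R[i]) ^+ k =
  ((~~ odd k)%:R * (-1) ^+ k./2) +i* ((odd k)%:R * (-1) ^+ k.-1./2).
Proof.
have [b ->] : exists b, k = (odd k + b.*2)%N by exists k./2; rewrite odd_double_half.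
have E : ('i : R[i]) ^+ b.*2 = ((-1) ^+ b)%:C.
  by rewrite -muln2 mulnC exprM sqr_i rmorphXn rmorphN1.
case: (odd k) => /=.
  rewrite add1n /= uphalf_double doubleK odd_double /= exprS E mul0r mul1r.
  by apply/eqP; rewrite eq_complex /= !mul0r !mul1r subrr add0r !eqxx.
by rewrite add0n E odd_double /= mul1r mul0r doubleK.
Qed.

Lemma cvg_cis (R : realType) (x : R) :
  series (fun k => k`!%:R^-1 * ('i * x%:C) ^+ k : (R[i] : numFieldType)) @ \oo
    --> (cis x : (R[i] : numFieldType)).
Proof.
pose u k : (R[i] : numFieldType) := k`!%:R^-1 * ('i * x%:C) ^+ k.
have uE k : u k = cos_coeff x k +i* sin_coeff x k.
  rewrite /u exprMn imagi_exp -rmorphXn.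
  have -> : k`!%:R^-1 = (k`!%:R^-1)%:C :> R[i] by rewrite fmorphV rmorph_nat.
  rewrite /cos_coeff /sin_coeff /= -?exprnP.
  by apply/eqP; rewrite eq_complex /= !(mulr0, mul0r, addr0, subr0);
    apply/andP; split; apply/eqP; rewrite -?exprnP; ring.
have sE m : series u m = series (cos_coeff x) m +i* series (sin_coeff x) m.
  rewrite /series /=; elim: m => [|m IH]; first by rewrite !big_geq.
  by rewrite !big_nat_recr //= IH uE.
have Hc : series (cos_coeff x) @ \oo --> cos x.
  by rewrite unlock; exact: is_cvg_series_cos_coeff.
have Hs : series (sin_coeff x) @ \oo --> sin x.
  by rewrite unlock; exact: is_cvg_series_sin_coeff.
apply/cvgrPdist_lt => e e0.
(* A positive element of [R[i]] is real, so the tolerance can be halved in [R] and shared between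
   the cosine and sine series. *)
have eR : e = (complex.Re e)%:C.
  by rewrite RRe_real // ger0_real // ltW.
move: e0; rewrite eR ltcR => e0.
have e20 : 0 < complex.Re e / 2 by rewrite divr_gt0.
move/cvgrPdist_lt: Hc => /(_ _ e20) Hc; move/cvgrPdist_lt: Hs => /(_ _ e20) Hs.
near=> m.
rewrite sE (_ : cis x - _ =
  (cos x - series (cos_coeff x) m)%:C + 'i * (sin x - series (sin_coeff x) m)%:C); last first.
  by apply/eqP; rewrite eq_complex /= !(mul0r, mul1r, mulr0, subr0, addr0, add0r) !eqxx.
apply: le_lt_trans (ler_normD _ _) _.
rewrite normrM (_ : `|'i| = 1 :> R[i]) ?mul1r; last first.
  by rewrite normc_def /= expr0n expr1n add0r sqrtr1.
rewrite !normc_def /= !expr0n !addr0 !sqrtr_sqr -rmorphD ltcR.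
rewrite [ltRHS](_ : _ = complex.Re e / 2 + complex.Re e / 2); last by field.
by apply: ltrD; near: m.
Unshelve. all: by end_near. Qed.

End Convergence.

Section Exponential.
Local Open Scope classical_set_scope.

(** Conjugation commutes with powers, so each entry of a partial sum is a fixed finite combination
    of scalar partial sums, and the limit can be taken entry by entry. *)
Lemma expmx_conj_diag (K : numFieldType) (n : nat) (P : 'M[K]_n) (d e : 'rV[K]_n) :
  P \in unitmx ->
  (forall k, series (fun m => m`!%:R^-1 * d 0 k ^+ m) @ \oo --> e 0 k) ->
  expmx (invmx P *m diag_mx d *m P) = invmx P *m diag_mx e *m P.
Proof.
move=> uP de; set A := _ *m P.
have powA m : A ^+ m = invmx P *m diag_mx (map_mx (fun x => x ^+ m) d) *m P.
  elim: m => [|m IH].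
    rewrite expr0 (_ : map_mx _ d = const_mx 1); last by apply/rowP => j; rewrite !mxE.
    by rewrite diag_const_mx mulmx1 mulVmx.
  rewrite exprS IH -mulmxE /A -!mulmxA; congr (_ *m _).
  rewrite (mulmxA P) mulmxV // mul1mx mulmxA; congr (_ *m _).
  by rewrite mulmx_diag; congr diag_mx; apply/rowP => j; rewrite !mxE exprS.
have entryE (x : 'rV[K]_n) i j :
    (invmx P *m diag_mx x *m P) i j = \sum_k invmx P i k * P k j * x 0 k.
  rewrite mxE; apply: eq_bigr => k _.
  rewrite mxE (bigD1 k) //= big1 ?addr0 => [|l lk].
    by rewrite mxE eqxx mulr1n mulrAC.
  by rewrite mxE (negbTE lk) mulr0n mulr0.
apply: cvg_lim; first exact: norm_hausdorff.
apply: cvg_mx => i j.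
rewrite (_ : (fun _ => _) = fun m => \sum_k invmx P i k * P k j *
    series (fun m => m`!%:R^-1 * d 0 k ^+ m) m); last first.
  apply/funext => m; rewrite /series /= summxE.
  under [RHS]eq_bigr do rewrite mulr_sumr.
  rewrite exchange_big /=; apply: eq_bigr => l _.
  rewrite mxE powA entryE mulr_sumr; apply: eq_bigr => k _.
  by rewrite mxE; ring.
rewrite entryE; apply: cvg_big => [|k _]; first exact: add_continuous.
by apply: cvgMl_tmp; exact: de.
Qed.

End Exponential.

(** * Unitary evolution generated by a Hermitian matrix *)

Section Unitary.
Local Open Scope sesquilinear_scope.

(** A Hermitian matrix has real spectrum, so the scalar series are those of [cvg_cis]; one unitary
    matrix then diagonalizes both [H] and the propagator. *)
Lemma qwalk_spectral (R : realType) (n : nat) (H : 'M[R[i]]_n) (t : R) :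
  H \is hermsymmx ->
  exists (P : 'M[R[i]]_n) (d : 'rV[R]_n),
    [/\ P \is unitarymx, H = P^t* *m diag_mx (map_mx (real_complex R) d) *m P &
     qwalk H t = P^t* *m diag_mx (map_mx (fun x => cis (t * x)) d) *m P].
Proof.
move=> Hh.
have uP := spectral_unitarymx H.
have /orthomx_spectralP HE := hermitian_normalmx Hh.
have dR := hermitian_spectral_diag_real Hh.
exists (spectralmx H), (map_mx (@complex.Re R) (spectral_diag H)).
have dE : map_mx (real_complex R) (map_mx (@complex.Re R) (spectral_diag H)) = spectral_diag H.
  apply/rowP => j; rewrite !mxE RRe_real //.
  by move/mxOverP: dR; apply.
split=> //; first by rewrite dE -invmx_unitary.
rewrite -invmx_unitary // /qwalk [in LHS]HE.
rewrite scalemxAl scalemxAr -linearZ /=.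
apply: expmx_conj_diag => [|k]; first exact: unitarymx_unit.
rewrite !mxE /=.
have := @cvg_cis R (t * complex.Re (spectral_diag H 0 k)).
rewrite rmorphM /= RRe_real; last by move/mxOverP: dR; apply.
by rewrite mulrA.
Qed.

Definition sqnorm (C : numDomainType) (n : nat) (x : 'I_n -> C) : C := \sum_i `|x i| ^+ 2.

Lemma dot_le_sqnorm (C : numFieldType) (n : nat) (e x y : 'I_n -> C) :
  (forall i, `|e i| <= 1) ->
  `|\sum_i x i * e i * y i| <= (sqnorm x + sqnorm y) / 2.
Proof.
move=> e1; apply: le_trans (ler_norm_sum _ _ _) _.
rewrite -big_split mulr_suml /=; apply: ler_sum => i _.
rewrite !normrM ler_pdivlMr ?ltr0n // mulrC mulr_natl.
apply: (@le_trans _ _ (`|x i| * `|y i| *+ 2)).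
  by rewrite lerMn2r /= ler_wpM2r // ler_piMr.
exact: (real_leif_mean_square_scaled (normr_real _) (normr_real _)).1.
Qed.

Lemma sqnorm_unitary (C : numClosedFieldType) (n : nat) (P : 'M[C]_n) (x : 'rV[C]_n) :
  P \is unitarymx -> sqnorm ((x *m P) 0) = sqnorm (x 0).
Proof.
have sqE (y : 'rV[C]_n) : sqnorm (y 0) = (y *m y ^t*) 0 0.
  by rewrite mxE; apply: eq_bigr => i _; rewrite !mxE normCK.
move=> /unitarymxP uP.
by rewrite !sqE trmx_mul map_mxM /= mulmxA -(mulmxA x) uP mulmx1.
Qed.

Lemma cis_norm (R : realType) (x : R) : `|cis x| = 1.
Proof. by rewrite normc_def /= cos2Dsin2 sqrtr1. Qed.

Section Propagator.
Variables (R : realType) (n : nat) (H : 'M[R[i]]_n) (t : R).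
Hypothesis Hh : H \is hermsymmx.

(** In the spectral basis every nonzero coordinate of an eigenvector sits at a diagonal entry equal
    to [lam], so all of them acquire the same phase. *)
Lemma qwalk_eigen_row (lam : R) (x : 'rV[R[i]]_n) :
  x *m H = lam%:C *: x -> x *m qwalk H t = cis (t * lam) *: x.
Proof.
have [P [d [uP HE ->]]] := qwalk_spectral t Hh => xH.
have PPs : P *m P^t* = 1%:M by apply/unitarymxP.
have PsP : P^t* *m P = 1%:M by apply: mulmx1C.
pose y := x *m P^t*.
have yd : y *m diag_mx (map_mx (real_complex R) d) = lam%:C *: y.
  have := congr1 (mulmx^~ (P^t* )) xH => /=.
  by rewrite HE !mulmxA -(mulmxA _ P) PPs mulmx1 -scalemxAl.
have xE : x = y *m P by rewrite /y -mulmxA PsP mulmx1.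
rewrite !mulmxA -/y [in RHS]xE scalemxAl; congr (_ *m _).
apply/rowP => j; rewrite !mul_mx_diag !mxE.
move/rowP: yd => /(_ j); rewrite mul_mx_diag !mxE => /eqP.
rewrite mulrC -subr_eq0 -mulrBl mulf_eq0 subr_eq0 => /orP[/eqP[->]|/eqP ->].
  by rewrite mulrC.
by rewrite mul0r mulr0.
Qed.

Lemma qwalk_eigen_col (lam : R) (x : 'cV[R[i]]_n) :
  H *m x = lam%:C *: x -> qwalk H t *m x = cis (t * lam) *: x.
Proof.
have [P [d [uP HE ->]]] := qwalk_spectral t Hh => xH.
have PPs : P *m P^t* = 1%:M by apply/unitarymxP.
have PsP : P^t* *m P = 1%:M by apply: mulmx1C.
pose y := P *m x.
have yd : diag_mx (map_mx (real_complex R) d) *m y = lam%:C *: y.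
  have := congr1 (mulmx P) xH => /=.
  by rewrite HE !mulmxA PPs mul1mx -scalemxAr -mulmxA.
have xE : x = P^t* *m y by rewrite /y mulmxA PsP mul1mx.
rewrite -!mulmxA -/y [in RHS]xE scalemxAr; congr (_ *m _).
apply/colP => j; rewrite !mul_diag_mx !mxE.
move/colP: yd => /(_ j); rewrite mul_diag_mx !mxE => /eqP.
rewrite -subr_eq0 -mulrBl mulf_eq0 subr_eq0 => /orP[/eqP[->]//|/eqP ->].
by rewrite !mulr0.
Qed.

(** In the spectral basis the propagator is diagonal with unimodular entries, and the change of
    basis preserves both norms. The form is bilinear, without conjugation, hence the use of
    [P^T]. *)
Lemma qwalk_form_le (x : 'rV[R[i]]_n) (y : 'cV[R[i]]_n) :
  `|(x *m qwalk H t *m y) 0 0| <= (sqnorm (x 0) + sqnorm (y^T 0)) / 2.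
Proof.
have [P [d [uP _ ->]]] := qwalk_spectral t Hh.
have uPs : P^t* \is unitarymx by rewrite trmxC_unitary.
have uPt : P^T \is unitarymx := etrans (trmx_unitary P) uP.
rewrite -(sqnorm_unitary x uPs) -(sqnorm_unitary y^T uPt) -trmx_mul.
rewrite !mulmxA -(mulmxA _ P) mxE.
pose e i := cis (t * d 0 i).
rewrite (eq_bigr (fun i => (x *m P^t*) 0 i * e i * (P *m y)^T 0 i)).
  by apply: dot_le_sqnorm => i; rewrite cis_norm.
by move=> i _; rewrite mul_mx_diag !mxE.
Qed.

End Propagator.

End Unitary.

(** * State transfer from approximate end states *)

Section Transfer.
Variables (C : numClosedFieldType) (n : nat) (U : 'M[C]_n) (f l : 'I_n).
Variables (mus mua : C) (X A : 'rV[C]_n).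
Hypotheses (fl : f != l) (mus1 : `|mus| = 1) (mua1 : `|mua| = 1).
Hypotheses (XU : X *m U = mus *: X) (UX : U *m X^T = mus *: X^T).
Hypotheses (AU : A *m U = mua *: A) (UA : U *m A^T = mua *: A^T).
Hypotheses (Xf : X 0 f = 1) (Xl : X 0 l = 1) (Af : A 0 f = 1) (Al : A 0 l = - 1).
Hypothesis U_form_le : forall (x : 'rV[C]_n) (y : 'cV[C]_n),
  `|(x *m U *m y) 0 0| <= (sqnorm (x 0) + sqnorm (y^T 0)) / 2.

Let bulk (x : 'rV[C]_n) : 'rV[C]_n := \row_j (if (j == f) || (j == l) then 0 else x 0 j).
Let form (x y : 'rV[C]_n) := (x *m U *m y^T) 0 0.
Let dot (x y : 'rV[C]_n) := (x *m y^T) 0 0.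

(* Expanding delta_f = (X + A - bulk X - bulk A) / 2 and delta_l = (X - A - bulk X + bulk A) / 2,
   every term of delta_f U delta_l that is linear in a bulk part has X or A on the
   other side; U acts on it as a scalar, and X, A meet a bulk part only through
   their own bulk parts.  Hence the error is quadratic. *)
Lemma transfer_lower_bound :
  `|mus - mua| / 2 - (sqnorm (bulk X 0) + sqnorm (bulk A 0)) <= `|U f l|.
Proof.
pose ef : 'rV[C]_n := delta_mx 0 f; pose el : 'rV[C]_n := delta_mx 0 l.
have lf : l != f by rewrite eq_sym.
have XE : X = ef + el + bulk X.
  apply/rowP => j; rewrite !mxE /=.
  have [->|jf] := eqVneq j f; first by rewrite (negbTE fl) Xf /= !addr0.
  have [->|jl] := eqVneq j l; first by rewrite Xl /= add0r addr0.
  by rewrite !add0r.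
have AE : A = ef - el + bulk A.
  apply/rowP => j; rewrite !mxE /=.
  have [->|jf] := eqVneq j f; first by rewrite (negbTE fl) Af /= subr0 addr0.
  have [->|jl] := eqVneq j l; first by rewrite Al /= add0r addr0.
  by rewrite subr0 !add0r.
have formXr x : form x X = mus * dot x X.
  by rewrite /form /dot -mulmxA UX -scalemxAr mxE.
have formAr x : form x A = mua * dot x A.
  by rewrite /form /dot -mulmxA UA -scalemxAr mxE.
have formXl x : form X x = mus * dot X x.
  by rewrite /form /dot XU -scalemxAl mxE.
have formAl x : form A x = mua * dot A x.
  by rewrite /form /dot AU -scalemxAl mxE.
have formDl x y z : form (x + y) z = form x z + form y z.
  by rewrite /form !mulmxDl mxE.
have formDr x y z : form x (y + z) = form x y + form x z.
  by rewrite /form linearD mulmxDr mxE.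
have formNr x y : form x (- y) = - form x y.
  by rewrite /form linearN mulmxN mxE.
have dotE x y : dot x y = \sum_j x 0 j * y 0 j.
  by rewrite /dot mxE; apply: eq_bigr => j _; rewrite mxE.
(* A bulk part vanishes at both ends, so it only sees the bulk part of the other vector. *)
have dot_bulk x y : dot (bulk x) y = dot (bulk x) (bulk y).
  by rewrite !dotE; apply: eq_bigr => j _; rewrite !mxE; case: ifP; rewrite ?mul0r.
have dotel x : dot x el = x 0 l.
  rewrite dotE (bigD1 l) //= big1 => [|j jl].
    by rewrite mxE !eqxx mulr1 addr0.
  by rewrite mxE (negbTE jl) mulr0.
set bs := bulk X in XE *; set ba := bulk A in AE *.
have Ufl : U f l = form ef el.
  rewrite /form -rowE (_ : el^T = delta_mx l 0) -?colE ?mxE //.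
  by rewrite /el trmx_delta.
have form_X y : form X y = form ef y + form el y + form bs y.
  by rewrite -!formDl -XE.
have form_A y : form A y = form ef y - form el y + form ba y.
  by rewrite AE !formDl {2}/form mulNmx mulNmx mxE.
have form_rX x : form x X = form x ef + form x el + form x bs.
  by rewrite -!formDr -XE.
have form_rA x : form x A = form x ef - form x el + form x ba.
  by rewrite -formNr -!formDr -AE.
pose p := form bs el; pose q := form ba el.
(* Pairing [X] and [A] with [el] gives [mus] and [- mua]; in the sum the return amplitude
   [form el el] cancels. *)
have E1 : mus - mua = 2 * U f l + p + q.
  have e1 := formXl el; have e2 := formAl el.
  rewrite !dotel Xl Al mulr1 mulrN1 in e1 e2.
  rewrite -e1 -e2 form_X form_A -Ufl /p /q; ring.
have E2 : 2 * p = mus * dot bs bs - mua * dot bs ba - (form bs bs - form bs ba).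
  rewrite -(dot_bulk X X) -(dot_bulk X A) -/bs -formXr -formAr form_rX form_rA /p; ring.
have E3 : 2 * q = mus * dot ba bs - mua * dot ba ba - (form ba bs - form ba ba).
  rewrite -(dot_bulk A X) -(dot_bulk A A) -/ba -formXr -formAr form_rX form_rA /q; ring.
(* The eight bilinear terms in [2 * p + 2 * q] are bounded together by four times the sum of the two
   bulk norms, which the factor 1/4 absorbs. *)
have key : (mus - mua) / 2 = U f l + 4^-1 * (2 * p + 2 * q) by rewrite E1; field.
rewrite lerBlDr -(ger0_norm (ler0n C 2)) -normfV -normrM key.
apply: le_trans (ler_normD _ _) _; rewrite lerD2l normrM (ger0_norm (_ : 0 <= 4^-1)) //.
have dot_le x y : `|dot x y| <= (sqnorm (x 0) + sqnorm (y 0)) / 2.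
  rewrite dotE (eq_bigr (fun j => x 0 j * 1 * y 0 j)); last by move=> j _; rewrite mulr1.
  by apply: (@dot_le_sqnorm _ _ (fun=> 1)) => j; rewrite normr1.
have form_le x y : `|form x y| <= (sqnorm (x 0) + sqnorm (y 0)) / 2.
  by have := U_form_le x y^T; rewrite trmxK.
rewrite mulrC ler_pdivrMr //.
have tri u v w z cu cv cw cz : `|u| <= cu -> `|v| <= cv -> `|w| <= cw -> `|z| <= cz ->
    `|mus * u - mua * v - (w - z)| <= cu + cv + (cw + cz) :> C.
  move=> hu hv hw hz; apply: le_trans (ler_normB _ _) _; apply: lerD.
    apply: le_trans (ler_normB _ _) _.
    by rewrite !normrM mus1 mua1 !mul1r lerD.
  by apply: le_trans (ler_normB _ _) _; rewrite lerD.
rewrite E2 E3; apply: le_trans (ler_normD _ _) _.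
apply: le_trans (lerD (tri _ _ _ _ _ _ _ _ (dot_le _ _) (dot_le _ _) (form_le _ _) (form_le _ _))
  (tri _ _ _ _ _ _ _ _ (dot_le _ _) (dot_le _ _) (form_le _ _) (form_le _ _))) _.
by rewrite le_eqVlt; apply/orP; left; apply/eqP; field.
Qed.

End Transfer.

(** * Eigenvectors of the chain *)

Section Chain.
Variables (R : realType) (n : nat) (Q : R).
Hypothesis n5 : (5 <= n)%N.

Lemma path_adjE (K : pzRingType) (i j : 'I_n) : path_adj K n i j = path_adj K n j i.
Proof. by rewrite !mxE orbC. Qed.

Lemma chain_hamiltonian_sym : (chain_hamiltonian n Q)^T = chain_hamiltonian n Q.
Proof.
rewrite /chain_hamiltonian linearD linearZ /= tr_diag_mx; congr (_ + _).
by apply/matrixP => i j; rewrite mxE path_adjE.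
Qed.

Lemma chain_hamiltonianE i j : chain_hamiltonian n Q i j =
  (((j == i.+1 :> nat)%:R + (i == j.+1 :> nat)%:R) +
   ((i == j) && ((j == 1 :> nat) || (j.+2 == n)))%:R * Q)%:C.
Proof.
rewrite !mxE !rmorphD rmorphM /= !rmorph_nat; congr (_ + _).
  have [->|_] := eqVneq (j : nat) i.+1; last by rewrite add0r.
  by rewrite (_ : (i == i.+2 :> nat) = false) ?addr0 //; lia.
rewrite mulrC.
have [->|ij] := eqVneq i j; rewrite ?mulr0n ?mul0r // mulr1n.
congr (_ * _); congr (_%:R); congr (nat_of_bool _).
lia.
Qed.

Lemma chain_hamiltonian_herm : chain_hamiltonian n Q \is hermsymmx.
Proof.
apply: realsym_hermsym.
  by apply/is_hermitianmxP; rewrite expr0 scale1r chain_hamiltonian_sym map_mx_id.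
apply/mxOverP => i j; rewrite chain_hamiltonianE.
by rewrite complex_real.
Qed.

Definition chain_state (c0 c1 : R) (F : nat -> R) (j : nat) : R :=
  if j == 0 then c0 else if j == n.-1 then c1 else F j.

(** The wave [F] is extended virtually to the end nodes, where the true amplitudes are [c0] and
    [c1]. Subtracting its recurrence from the eigenvalue equation next to an end leaves only the
    mismatch there, which [Q] has to compensate. *)
Lemma chain_state_eigen (lam c0 c1 : R) (F : nat -> R) :
  (forall j, F j + F j.+2 = lam * F j.+1) ->
  lam * c0 = F 1 -> F 0 - c0 = Q * F 1 ->
  lam * c1 = F n.-2 -> F n.-1 - c1 = Q * F n.-2 ->
  let x : 'rV[R[i]]_n := \row_j (chain_state c0 c1 F j)%:C in
  x *m chain_hamiltonian n Q = lam%:C *: x.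
Proof.
move=> FE e0 e0' e1 e1' /=.
pose g := chain_state c0 c1 F.
apply/rowP => j; rewrite !mxE.
under eq_bigr do rewrite mxE chain_hamiltonianE -rmorphM.
rewrite -rmorph_sum -rmorphM /=; congr (_%:C).
rewrite (eq_bigr (fun i : 'I_n => g i * (j == i.+1 :> nat)%:R +
   g i * (i == j.+1 :> nat)%:R + g i * (((i == j) && ((j == 1 :> nat) || (j.+2 == n)))%:R * Q)));
  last by move=> i _; rewrite !mulrDr.
rewrite !big_split /=.
have S1 : \sum_(i < n) g i * (j == i.+1 :> nat)%:R = if j == 0 :> nat then 0 else g j.-1.
  case: j => -[|j] jn /=; first by rewrite big1 // => i _; rewrite mulr0.
  rewrite (bigD1 (Ordinal (ltnW jn))) //= eqxx mulr1 big1 ?addr0 // => i ij.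
  by rewrite eqSS (_ : (j == i) = false) ?mulr0 //; apply: contraNF ij => /eqP E; apply/eqP/val_inj.
have S2 : \sum_(i < n) g i * (i == j.+1 :> nat)%:R = if j == n.-1 :> nat then 0 else g j.+1.
  case: ifPn => jn.
    rewrite big1 // => i _; rewrite (_ : (i == j.+1 :> nat) = false) ?mulr0 //.
    by have := ltn_ord i; lia.
  have j1n : (j.+1 < n)%N by have := ltn_ord j; lia.
  rewrite (bigD1 (Ordinal j1n)) //= eqxx mulr1 big1 ?addr0 // => i ij.
  by rewrite (_ : (i == j.+1 :> nat) = false) ?mulr0 //; apply: contraNF ij => /eqP E; apply/eqP/val_inj.
have S3 : \sum_(i < n) g i * (((i == j) && ((j == 1 :> nat) || (j.+2 == n)))%:R * Q) =
    if (j == 1 :> nat) || (j.+2 == n) then Q * g j else 0.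
  rewrite (bigD1 j) //= eqxx /= big1 ?addr0 => [|i ij].
    by case: ifP => _; rewrite ?mul1r ?mul0r ?mulr0 // mulrC.
  by rewrite (negbTE ij) mul0r mulr0.
rewrite S1 S2 S3 -/(g j) {S1 S2 S3}.
have g0 : g 0 = c0 by [].
have gl : g n.-1 = c1 by rewrite /g /chain_state eqxx ifF //; lia.
have gF k : (0 < k < n.-1)%N -> g k = F k.
  by move=> k0; rewrite /g /chain_state !ifF //; lia.
case: j => j jn /=.
have [->|j0] := eqVneq j 0.
  rewrite !ifF ?g0 ?gF; try lia; lra.
have [jE|jl] := eqVneq j n.-1.
  rewrite ifF; last lia.
  rewrite jE gl gF; last lia.
  lra.
have [jE|j1] := eqVneq j 1.
  rewrite jE /= g0 !gF; try lia.
  have := FE 0; lra.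
have [jE|jl2] := eqVneq j.+2 n.
  have jE' : j.+1 = n.-1 by lia.
  have jE2 : n.-2 = j by lia.
  have := FE j.-1; rewrite prednK; last lia.
  rewrite jE' gl !gF; try lia.
  move: e1 e1'; rewrite jE2 /=; lra.
have := FE j.-1; rewrite prednK; last lia.
rewrite /= !gF; try lia.
lra.
Qed.

End Chain.

(** * Trigonometric estimates *)

Section TrigEstimates.
Variable R : realType.
Implicit Types x y M : R.

Lemma le_of_sqr_le x y : 0 <= y -> x ^+ 2 <= y ^+ 2 -> x <= y.
Proof.
move=> y0 h; rewrite leNgt; apply/negP => yx; move: h; rewrite leNgt => /negP; apply.
by rewrite ltrXn2r // nnegrE ltW // (le_lt_trans y0).
Qed.

Lemma sqr_le_of_abs_le x y : `|x| <= y -> x ^+ 2 <= y ^+ 2.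
Proof.
move=> h; rewrite -(real_normK (num_real x)) lerXn2r ?nnegrE //.
exact: le_trans h.
Qed.

Lemma sin_mean_value x y : exists2 xi : R,
  Num.min x y <= xi <= Num.max x y & sin x - sin y = cos xi * (x - y).
Proof.
wlog xy : x y / y <= x.
  move=> W; have /orP[xy|xy] := le_total y x; first exact: W.
  have [xi h e] := W _ _ xy; exists xi; first by rewrite minC maxC.
  by rewrite -opprB e -mulrN opprB.
have [xi] := @MVT_segment R sin cos y x xy (fun z _ => is_derive_sin z)
  (continuous_subspaceT (@continuous_sin R)).
rewrite in_itv /= => h e; exists xi => //.
by rewrite min_r // max_l.
Qed.

Lemma abs_sin_sub_le x y : `|sin x - sin y| <= `|x - y|.
Proof.
have [xi _ ->] := sin_mean_value x y.
by rewrite normrM ler_piMl // cos_max.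
Qed.

Lemma cos_ge_quadratic x : 1 - x ^+ 2 / 2 <= cos x.
Proof.
have -> : cos x = 1 - 2 * sin (x / 2) ^+ 2.
  have {1}-> : x = (x / 2) *+ 2 by rewrite -mulr_natr mulfVK.
  rewrite cos_mulr2n cos2sin2; ring.
have h : sin (x / 2) ^+ 2 <= (x / 2) ^+ 2.
  have := abs_sin_sub_le (x / 2) 0; rewrite sin0 !subr0 => h.
  by apply: le_trans (sqr_le_of_abs_le h) _; rewrite real_normK ?num_real.
have : (x / 2) ^+ 2 = x ^+ 2 / 4 by field.
lra.
Qed.

(** Replacing sines by linear terms with a slope near one reduces the later estimates to linear and
    polynomial arithmetic. *)
Lemma sin_slope x y M : `|x| <= M -> `|y| <= M ->
  exists2 u : R, 1 - M ^+ 2 / 2 <= u <= 1 & sin x - sin y = u * (x - y).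
Proof.
move=> xM yM; have [xi h e] := sin_mean_value x y.
exists (cos xi) => //; rewrite cos_le1 andbT.
apply: le_trans (cos_ge_quadratic xi); rewrite lerD2l lerN2 ler_pM2r ?invr_gt0 //.
apply: sqr_le_of_abs_le; rewrite ler_norml; move: h xM yM.
by rewrite !ler_norml /Num.min /Num.max; case: ifP => _; lra.
Qed.

Lemma sin_slope0 x M : `|x| <= M -> exists2 u : R, 1 - M ^+ 2 / 2 <= u <= 1 & sin x = u * x.
Proof.
move=> xM; have [|u hu] := @sin_slope x 0 M xM.
  by rewrite normr0; exact: le_trans xM.
by rewrite sin0 !subr0 => e; exists u.
Qed.

Lemma continuous_root (f : R -> R) (x y : R) : x <= y -> continuous f ->
  f x * f y <= 0 -> exists2 z, x <= z <= y & f z = 0.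
Proof.
move=> xy cf fxy.
have [||z zi fz] := @IVT R f x y 0 xy; last by exists z => //; move: zi; rewrite in_itv.
  exact: continuous_subspaceT.
rewrite /Num.min /Num.max; case: ltP => h; apply/andP; split; nra.
Qed.

Lemma pi_bounds : 2 <= (pi : R) <= 4.
Proof. by rewrite pi_ge2 /=; have /andP[_] := pihalf_02 R; lra. Qed.

Lemma mul_near_one x y p q : 0 <= p <= 1 -> 0 <= q <= 1 ->
  1 - p <= x <= 1 -> 1 - q <= y <= 1 -> 1 - (p + q) <= x * y <= 1.
Proof.
move=> /andP[p0 p1] /andP[q0 q1] /andP[x0 x1] /andP[y0 y1].
have xge0 : 0 <= x by lra.
have yge0 : 0 <= y by lra.
rewrite mulr_ile1 // andbT.
have := mulr_ge0 p0 q0; have : (1 - p) * (1 - q) <= x * y by apply: ler_pM; lra.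
lra.
Qed.

Lemma mul_slope_bounds u e x y : 1 - e <= u <= 1 -> 0 <= x <= y ->
  x - e * y <= u * x <= x.
Proof.
move=> /andP[u0 u1] /andP[x0 xy]; rewrite ler_piMl // andbT.
have h1 : (1 - u) * x <= e * x by apply: ler_wpM2r => //; lra.
have h2 : e * x <= e * y by apply: ler_wpM2l => //; lra.
lra.
Qed.

End TrigEstimates.

(** * Roots of the eigenvalue equations *)

Section Resonance.
Variables (R : realType).

(* The eigenvalue equations of the symmetric and antisymmetric sectors at energy
   2 sin (a + psi), for Q = - (2 sin a)^-1, with denominators cleared. *)
Definition sym_char (a L psi : R) : R :=
  2 * sin a * sin (a + psi) * cos (psi * L + (a + psi)) -
  (sin (a + psi) - sin a) * sin (psi * L).

Definition anti_char (a L psi : R) : R :=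
  2 * sin a * sin (a + psi) * sin (psi * L + (a + psi)) +
  (sin (a + psi) - sin a) * cos (psi * L).

(* b is the leading-order value of |psi| for the two symmetric levels. *)
Definition weak_coupling (a L eta b : R) : Prop :=
  [/\ [/\ 0 < a, 0 < L & 0 < b], 0 < eta <= 1 / 100,
      a ^+ 2 * L <= eta ^+ 2, 1 <= eta ^+ 2 * L & b ^+ 2 * L = 2 * a ^+ 2].

Variables (a L eta b : R).
Hypothesis weak : weak_coupling a L eta b.

(** Multiplying [a ^+ 2] by [eta ^+ 2 * L], which is at least one, leaves at most [eta ^+ 4]. The
    bound on [b] uses the same factor. *)
Lemma a_le : a <= eta ^+ 2.
Proof.
have [[a0 L0 b0] /andP[eta0 eta_small] aL L_large bL] := weak.
have h : a ^+ 2 <= (eta ^+ 2) ^+ 2.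
  apply: (@le_trans _ _ (a ^+ 2 * (eta ^+ 2 * L))).
    by rewrite -[leLHS]mulr1 ler_pM2l ?exprn_gt0.
  by rewrite mulrCA [leRHS]expr2 ler_pM2l ?exprn_gt0.
by apply: le_of_sqr_le h; rewrite exprn_ge0 // ltW.
Qed.

Lemma b_le : b <= 2 * eta * a.
Proof.
have [[a0 L0 b0] /andP[eta0 eta_small] aL L_large bL] := weak.
have h : b ^+ 2 <= (2 * eta * a) ^+ 2.
  apply: (@le_trans _ _ (b ^+ 2 * (eta ^+ 2 * L))).
    by rewrite -[leLHS]mulr1 ler_pM2l ?exprn_gt0.
  rewrite mulrCA bL.
  have : 0 < eta ^+ 2 * a ^+ 2 by rewrite mulr_gt0 ?exprn_gt0.
  have -> : (2 * eta * a) ^+ 2 = 4 * (eta ^+ 2 * a ^+ 2) by ring.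
  lra.
by apply: le_of_sqr_le h; rewrite !mulr_ge0 // ltW.
Qed.

Lemma bL_le : b * L <= 2 * eta.
Proof.
have [[a0 L0 b0] /andP[eta0 eta_small] aL L_large bL] := weak.
have h : (b * L) ^+ 2 <= (2 * eta) ^+ 2.
  rewrite exprMn [L ^+ 2]expr2 mulrA bL -mulrA exprMn.
  have := exprn_gt0 2 eta0; have -> : 2 ^+ 2 = 4 :> R by ring.
  move: aL; lra.
by apply: le_of_sqr_le h; rewrite mulr_ge0 // ltW.
Qed.

Lemma eta_sq : 100 * eta ^+ 2 <= eta.
Proof.
have [[a0 L0 b0] /andP[eta0 eta_small] aL L_large bL] := weak.
have := ler_wpM2l (ltW eta0) eta_small; rewrite expr2; lra. Qed.

Lemma psi_bounds psi : `|psi| <= 2 * b -> `|psi| <= 4 * eta * a /\ `|psi * L| <= 4 * eta.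
Proof.
have [[a0 L0 b0] /andP[eta0 eta_small] aL L_large bL] := weak.
move=> h; split; first by have := b_le; lra.
rewrite normrM (gtr0_norm L0).
apply: (@le_trans _ _ (2 * b * L)); first by rewrite ler_pM2r.
have := bL_le; lra.
Qed.

(** All arguments involved are at most [6 * eta] in absolute value, so the quadratic errors are at
    most [18 * eta ^+ 2], which is below [eta] by [eta_sq]. *)
Lemma trig_slopes psi : `|psi| <= 2 * b ->
  [/\ exists2 u : R, 1 - eta <= u <= 1 & sin a = u * a,
      exists2 u : R, 1 - eta <= u <= 1 & sin (a + psi) = u * (a + psi),
      exists2 u : R, 1 - eta <= u <= 1 & sin (a + psi) - sin a = u * psi,
      exists2 u : R, 1 - eta <= u <= 1 & sin (psi * L) = u * (psi * L) &
      1 - eta <= cos (psi * L + (a + psi)) /\ 1 - eta <= cos (psi * L)].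
Proof.
have [[a0 L0 b0] /andP[eta0 eta_small] aL L_large bL] := weak.
move=> hpsi; have [h1 h2] := psi_bounds hpsi.
have ha := a_le; have he := eta_sq.
have a_eta : a <= eta by have := ltW eta0; lra.
have hpsia : `|psi| <= a.
  apply: le_trans h1 _; rewrite -[leRHS]mul1r ler_pM2r //; lra.
have M1 : `|a| <= 2 * a by rewrite gtr0_norm; lra.
have M2 : `|a + psi| <= 2 * a.
  by apply: le_trans (ler_normD _ _) _; rewrite (gtr0_norm a0); lra.
have sq : (2 * a) ^+ 2 / 2 <= eta.
  have -> : (2 * a) ^+ 2 / 2 = 2 * (a * a) by field.
  have : a * a <= eta * eta by apply: ler_pM => //; exact: ltW.
  rewrite -expr2; lra.
have sq4 : (4 * eta) ^+ 2 / 2 <= eta.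
  have -> : (4 * eta) ^+ 2 / 2 = 8 * (eta ^+ 2) by field.
  lra.
split.
- have [u hu e] := sin_slope0 M1; exists u => //; lra.
- have [u hu e] := sin_slope0 M2; exists u => //; lra.
- have [u hu e] := sin_slope M2 M1; exists u; first by lra.
  by rewrite e; congr (_ * _); ring.
- have [u hu e] := sin_slope0 h2; exists u => //; lra.
have cosb x : `|x| <= 6 * eta -> 1 - eta <= cos x.
  move=> xe; apply: le_trans (cos_ge_quadratic x); rewrite lerD2l lerN2.
  have := sqr_le_of_abs_le xe.
  have -> : (6 * eta) ^+ 2 = 36 * eta ^+ 2 by ring.
  lra.
split; apply: cosb; last by lra.
apply: le_trans (ler_normD _ _) _; lra.
Qed.

Lemma sym_char_approx psi : `|psi| <= 2 * b ->
  `|sym_char a L psi - (2 * a ^+ 2 - psi ^+ 2 * L)| <= 30 * (eta * a ^+ 2).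
Proof.
have [[a0 L0 b0] /andP[eta0 eta_small] aL L_large bL] := weak.
move=> hpsi; have [h1 h2] := psi_bounds hpsi.
have [[u1 hu1 e1] [u2 hu2 e2] [u hu e3] [v hv e4] [hc _]] := trig_slopes hpsi.
have c1 := cos_le1 (psi * L + (a + psi)).
rewrite /sym_char e3 e1 e2 e4; move: hc c1; set c := cos _ => hc c1.
have eta1 : 0 <= eta <= 1 by clear - weak eta0 eta_small; lra.
have eta2 : 0 <= eta + eta <= 1 by clear - weak eta0 eta_small; lra.
have hu12 := mul_near_one eta1 eta1 hu1 hu2.
have hP : 1 - (eta + eta + eta) <= u1 * u2 * c <= 1.
  by apply: mul_near_one; rewrite ?hc.
have hQ : 1 - (eta + eta) <= u * v <= 1 by exact: mul_near_one.
(* The three terms isolate the error of the constant, the shift of the energy by [psi], and the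
   error of the quadratic part; they contribute 6, 8 and 16 to the constant 30. *)
have -> : 2 * (u1 * a) * (u2 * (a + psi)) * c - u * psi * (v * (psi * L)) -
   (2 * a ^+ 2 - psi ^+ 2 * L) = 2 * a ^+ 2 * (u1 * u2 * c - 1)
   + 2 * a * (u1 * u2 * c) * psi + psi ^+ 2 * L * (1 - u * v) by ring.
have psiL : 0 <= psi ^+ 2 * L <= 8 * a ^+ 2.
  rewrite mulr_ge0 ?sqr_ge0 ?(ltW L0) //=.
  have := sqr_le_of_abs_le hpsi.
  move=> h; apply: (@le_trans _ _ ((2 * b) ^+ 2 * L)); first by rewrite ler_pM2r.
  rewrite exprMn -mulrA bL; lra.
have a20 : 0 < a ^+ 2 by rewrite exprn_gt0.
set P := u1 * u2 * c in hP *; set Q := u * v in hQ *.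
have T1 : `|2 * a ^+ 2 * (P - 1)| <= 6 * (eta * a ^+ 2).
  have -> : 6 * (eta * a ^+ 2) = 2 * a ^+ 2 * (3 * eta) by ring.
  rewrite normrM gtr0_norm ?mulr_gt0 // ler_pM2l ?mulr_gt0 // ler_norml.
  by clear - weak hP eta0; lra.
have T2 : `|2 * a * P * psi| <= 8 * (eta * a ^+ 2).
  have -> : 8 * (eta * a ^+ 2) = 2 * a * (4 * eta * a) by ring.
  rewrite -mulrA normrM gtr0_norm ?mulr_gt0 // ler_pM2l ?mulr_gt0 //.
  apply: le_trans h1; rewrite normrM ler_piMl // ler_norml.
  by clear - weak hP eta0 eta_small; lra.
have T3 : `|psi ^+ 2 * L * (1 - Q)| <= 16 * (eta * a ^+ 2).
  have -> : 16 * (eta * a ^+ 2) = 8 * a ^+ 2 * (2 * eta) by ring.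
  have /andP[psiL0 psiL8] := psiL.
  rewrite normrM ger0_norm //; apply: ler_pM => //.
  by rewrite ler_norml; clear - weak hQ eta0; lra.
apply: le_trans (ler_normD _ _) _.
apply: le_trans (lerD (ler_normD _ _) (lexx _)) _.
by clear - weak T1 T2 T3; lra.
Qed.

End Resonance.

(** * Locating the two symmetric levels and the antisymmetric level *)

Section Roots.
Variables (R : realType).
Implicit Types (s psi : R).
Variables (a L eta b : R).
Hypothesis weak : weak_coupling a L eta b.

Lemma continuous_sin_comp (f : R -> R) : continuous f -> continuous (fun x : R => sin (f x)).
Proof. by move=> cf x; apply: continuous_comp (cf x) _; exact: continuous_sin. Qed.

Lemma continuous_cos_comp (f : R -> R) : continuous f -> continuous (fun x : R => cos (f x)).
Proof. by move=> cf x; apply: continuous_comp (cf x) _; exact: continuous_cos. Qed.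

Lemma continuous_affine (p q : R) : continuous (fun x : R => p * x + q).
Proof.
by move=> x; apply: cvgD; [apply: cvgMl_tmp; exact: cvg_id|exact: cvg_cst].
Qed.

Lemma continuous_sym_char s : continuous (fun x : R => sym_char a L (s * x)).
Proof.
have c1 : continuous (fun x : R => sin (a + s * x)).
  apply: continuous_sin_comp; under eq_fun do rewrite addrC; exact: continuous_affine.
have c2 : continuous (fun x : R => cos (s * x * L + (a + s * x))).
  apply: continuous_cos_comp.
  rewrite [X in continuous X](_ : _ = (fun x : R => (s * L + s) * x + a)); first exact: continuous_affine.
  by apply/funext => x; ring.
have c3 : continuous (fun x : R => sin (s * x * L)).
  apply: continuous_sin_comp.
  rewrite [X in continuous X](_ : _ = (fun x : R => (s * L) * x + 0)); first exact: continuous_affine.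
  by apply/funext => x; ring.
move=> x; rewrite /sym_char; apply: cvgB.
  by apply: cvgM; [apply: cvgMl_tmp; exact: c1|exact: c2].
by apply: cvgM; [apply: cvgB; [exact: c1|exact: cvg_cst]|exact: c3].
Qed.

Lemma continuous_anti_char : continuous (anti_char a L).
Proof.
have c1 : continuous (fun x : R => sin (a + x)).
  apply: continuous_sin_comp.
  rewrite [X in continuous X](_ : _ = (fun x : R => 1 * x + a)); first exact: continuous_affine.
  by apply/funext => x; ring.
have c2 : continuous (fun x : R => sin (x * L + (a + x))).
  apply: continuous_sin_comp.
  rewrite [X in continuous X](_ : _ = (fun x : R => (L + 1) * x + a)); first exact: continuous_affine.
  by apply/funext => x; ring.
have c3 : continuous (fun x : R => cos (x * L)).
  apply: continuous_cos_comp.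
  rewrite [X in continuous X](_ : _ = (fun x : R => L * x + 0)); first exact: continuous_affine.
  by apply/funext => x; ring.
move=> x; rewrite /anti_char; apply: cvgD.
  by apply: cvgM; [apply: cvgMl_tmp; exact: c1|exact: c2].
by apply: cvgM; [apply: cvgB; [exact: c1|exact: cvg_cst]|exact: c3].
Qed.

(** The leading part [2 * a ^+ 2 - psi ^+ 2 * L] goes from [2 * a ^+ 2] at 0 to [- 6 * a ^+ 2] at
    distance [2 * b], far beyond the error, so a root lies between. The approximation at the root
    then controls [x ^+ 2 - b ^+ 2], and dividing by [x + b], at least [b], gives the distance. The
    sign [s] treats both levels at once. *)
Lemma sym_root s : s = 1 \/ s = -1 ->
  exists psi : R, [/\ sym_char a L psi = 0, 0 < s * psi & `|psi - s * b| <= 15 * (eta * b)].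
Proof.
have [[a0 L0 b0] /andP[eta0 eta_small] aL L_large bL] := weak.
move=> hs.
have s2 : s ^+ 2 = 1 by case: hs => ->; ring.
have sn x : `|s * x| = `|x| by case: hs => ->; rewrite ?mul1r // mulN1r normrN.
have a20 : 0 < a ^+ 2 by rewrite exprn_gt0.
have ea : eta * a ^+ 2 <= 1 / 100 * a ^+ 2 by rewrite ler_pM2r.
have f0 : 0 < sym_char a L (s * 0).
  have := @sym_char_approx _ _ _ _ _ weak (s * 0).
  rewrite sn normr0 mulr0 expr0n mul0r subr0 => /(_ _); rewrite ler_norml.
  move=> /(_ ltac:(lra)); lra.
have f1 : sym_char a L (s * (2 * b)) < 0.
  have := @sym_char_approx _ _ _ _ _ weak (s * (2 * b)).
  rewrite sn gtr0_norm; last lra.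
  rewrite exprMn s2 mul1r exprMn -mulrA bL ler_norml => /(_ (lexx _)); lra.
have b20 : 0 <= 2 * b by lra.
have [|x /andP[x0 xb] fx] := continuous_root b20 (continuous_sym_char (s := s)).
  by rewrite nmulr_lle0 // ltW.
exists (s * x); split=> //.
  rewrite mulrA -expr2 s2 mul1r lt_neqAle x0 andbT.
  by apply: contraTneq f0 => E; move: fx; rewrite -E => ->; rewrite ltxx.
have := @sym_char_approx _ _ _ _ _ weak (s * x).
rewrite -mulrBr !sn ger0_norm // => /(_ xb).
rewrite fx exprMn s2 mul1r sub0r normrN -bL => h.
have {}h : `|x ^+ 2 - b ^+ 2| <= 15 * (eta * b ^+ 2).
  rewrite -(ler_pM2r L0) -{1}(gtr0_norm L0) -normrM mulrBl distrC.
  apply: le_trans h _.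
  have -> : 15 * (eta * b ^+ 2) * L = 15 * eta * (b ^+ 2 * L) by ring.
  rewrite bL; lra.
rewrite -(ler_pM2r b0).
apply: (@le_trans _ _ (`|x - b| * (x + b))).
  by apply: ler_wpM2l => //; lra.
rewrite -(@ger0_norm _ (x + b)); last lra.
rewrite -normrM -subr_sqr; apply: le_trans h _; rewrite expr2; lra.
Qed.

(** The cubic term is at most [e / 2], while the negative one is at most [- (99 / 100) ^+ 2 * e]. It
    is applied with [x] equal to [a] and [e] equal to [eta * b]. *)
Lemma anti_sign_neg (x e s1 s2 w D c : R) : 0 <= x -> 0 <= s1 <= x -> 0 <= s2 <= x ->
  w <= x -> 4 * x ^+ 3 <= e -> D <= - (99 / 100 * e) -> 99 / 100 <= c ->
  2 * s1 * s2 * w + D * c <= 0.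
Proof.
move=> x0 /andP[s10 s1x] /andP[s20 s2x] wx xe De ce.
have t1 : s1 * s2 * w <= x ^+ 3.
  apply: (@le_trans _ _ (s1 * s2 * x)); first by rewrite ler_wpM2l // mulr_ge0.
  by rewrite [leRHS]exprSr ler_wpM2r // expr2 ler_pM.
have x30 : 0 <= x ^+ 3 by rewrite exprn_ge0.
have t2 : (- D) * (99 / 100) <= (- D) * c by apply: ler_wpM2l => //; lra.
have -> : 2 * s1 * s2 * w = 2 * (s1 * s2 * w) by ring.
rewrite mulNr in t2; lra.
Qed.

(** At zero detuning only the nonnegative cube [2 * sin a ^+ 3] remains; at [- (eta * b)] the linear
    term of size [eta * b] outweighs the cubic one. *)
Lemma anti_root : exists2 psi : R, - (eta * b) <= psi <= 0 & anti_char a L psi = 0.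
Proof.
have [[a0 L0 b0] /andP[eta0 eta_small] aL L_large bL] := weak.
have eb : 0 < eta * b by rewrite mulr_gt0.
have eb2 : eta * b <= b by rewrite ler_piMl; lra.
have ha := a_le weak; have he := eta_sq weak.
have x0 : `|0 : R| <= 2 * b by rewrite normr0; lra.
have x1 : `|- (eta * b)| <= 2 * b by rewrite normrN gtr0_norm; lra.
have sina : 0 < sin a <= a.
  have [[u /andP[hu hu'] ->] _ _ _ _] := trig_slopes weak x0.
  by rewrite pmulr_lgt0 ?ler_piMl //; lra.
have f0 : 0 <= anti_char a L 0.
  rewrite /anti_char !(mul0r, addr0, add0r, subrr, mulr0).
  by rewrite !mulr_ge0 //; lra.
have f1 : anti_char a L (- (eta * b)) <= 0.
  have [_ [u2 hu2 e2] [u hu e3] [v hv e4] [_ hc]] := trig_slopes weak x1.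
  have [h1 h2] := psi_bounds weak x1.
  have y : `|- (eta * b) * L + (a + - (eta * b))| <= 1.
    apply: le_trans (ler_normD _ _) _.
    have : `|a + - (eta * b)| <= a + `| - (eta * b)|.
      by apply: le_trans (ler_normD _ _) _; rewrite (gtr0_norm a0).
    have : 4 * eta * a <= a by rewrite ler_piMl; lra.
    lra.
  rewrite /anti_char e3.
  have [w /andP[w0 w1] ->] := sin_slope0 y.
  set c := cos _ in hc *; set z := - (eta * b) * L + _.
  have z_le : z <= a.
    have : 0 < eta * b * L by rewrite mulr_gt0.
    by rewrite /z mulNr; clear - weak eb; lra.
  have za : w * z <= a.
    have [z0|z0] := lerP 0 z; first by apply: le_trans z_le; rewrite ler_piMl.
    by apply: le_trans (ltW a0); rewrite mulr_ge0_le0 ?ltW //; clear - weak w0; lra.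
  have s1 : 0 <= sin (a + - (eta * b)) <= a.
    have ab : 0 <= a + - (eta * b) <= a.
      have := b_le weak.
      have : eta * b <= 1 / 100 * b by rewrite ler_pM2r.
      have : eta * a <= 1 / 100 * a by rewrite ler_pM2r.
      by clear - weak eb a0; lra.
    have /andP[ab0 aba] := ab.
    have /andP[h1u h2u] := hu2.
    have u20 : 0 <= u2 by clear - weak h1u eta_small; lra.
    rewrite e2 mulr_ge0 //=; apply: le_trans aba.
    by rewrite ler_piMl.
  have /andP[u_ge u_le] := hu.
  have D_le : u * - (eta * b) <= - (99 / 100 * (eta * b)).
    by rewrite mulrN lerN2 ler_pM2r //; clear - weak u_ge eta_small; lra.
  have c_ge : 99 / 100 <= c by clear - weak hc eta_small; lra.
  have /andP[sa0 sa_le] := sina.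
  apply: (anti_sign_neg (ltW a0) _ s1 za _ D_le c_ge); rewrite ?(ltW sa0) //.
  (* For [4 * a ^+ 3 <= eta * b], squaring lets [2 * a ^+ 2] be traded for [b ^+ 2 * L]; the factor
     [a ^+ 2 * L] then supplies [eta ^+ 2]. *)
  apply: le_of_sqr_le; first exact: ltW.
  have -> : (4 * a ^+ 3) ^+ 2 = 8 * a ^+ 4 * (2 * a ^+ 2) by ring.
  rewrite -bL.
  have -> : 8 * a ^+ 4 * (b ^+ 2 * L) = 8 * a ^+ 2 * (a ^+ 2 * L) * b ^+ 2 by ring.
  rewrite exprMn; apply: ler_wpM2r; first exact: sqr_ge0.
  rewrite -[leRHS]mul1r; apply: ler_pM => //.
  - by rewrite mulr_ge0 ?sqr_ge0.
  - by rewrite mulr_ge0 ?sqr_ge0 // ltW.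
  have a100 : a <= 1 / 100 by clear - weak ha he eta_small; lra.
  have : a ^+ 2 <= 1 / 100 * a by rewrite expr2 ler_pM2r.
  by clear - weak a100; lra.
have eb0 : - (eta * b) <= 0 by lra.
have [|x hx fx] := continuous_root eb0 continuous_anti_char.
  by rewrite mulr_le0_ge0.
by exists x.
Qed.

(** The last bound measures how far the antisymmetric level is from the midpoint of the two
    symmetric ones, relative to their splitting. This ratio becomes the phase error at the transfer
    time. *)
Lemma resonant_roots : exists p m z : R,
  [/\ [/\ sym_char a L p = 0, sym_char a L m = 0 & anti_char a L z = 0],
      [/\ 0 < p <= 2 * b, - (2 * b) <= m < 0 & - b <= z <= 0],
      3 / 2 * b <= sin (a + p) - sin (a + m) &
      `|sin (a + p) + sin (a + m) - 2 * sin (a + z)| <=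
        24 * eta * (sin (a + p) - sin (a + m))].
Proof.
have [[a0 L0 b0] /andP[eta0 eta_small] aL L_large bL] := weak.
have [p [fp p0 hp]] := sym_root (or_introl erefl).
have [m [fm m0 hm]] := sym_root (or_intror erefl).
have [z hz fz] := anti_root.
exists p, m, z.
rewrite mul1r mulN1r in p0 m0 hp hm.
have eb : 0 < eta * b by rewrite mulr_gt0.
have eb2 : eta * b <= 1 / 100 * b by rewrite ler_pM2r.
move: hp hm; rewrite !ler_norml => hp hm.
have np : `|p| <= 2 * b by rewrite ler_norml; lra.
have nm : `|m| <= 2 * b by rewrite ler_norml; lra.
have nz : `|z| <= 2 * b by rewrite ler_norml; lra.
have [_ _ [u hu eu] _ _] := trig_slopes weak np.
have [_ _ [v hv ev] _ _] := trig_slopes weak nm.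
have [_ _ [w hw ew] _ _] := trig_slopes weak nz.
have p2b : 0 <= p <= 2 * b by clear - weak p0 hp eb2 b0; lra.
have m2b : 0 <= - m <= 2 * b by clear - weak m0 hm eb2 b0; lra.
have zb : 0 <= - z <= eta * b by clear - weak hz; lra.
have up := mul_slope_bounds hu p2b.
have vm := mul_slope_bounds hv m2b.
have wz := mul_slope_bounds hw zb.
have eebb : eta * (eta * b) <= eta * b by rewrite ler_piMl ?(ltW eb) //; clear - weak eta_small; lra.
rewrite !mulrN in vm wz.
have -> : sin (a + p) = sin a + u * p by rewrite -eu; ring.
have -> : sin (a + m) = sin a + v * m by rewrite -ev; ring.
have -> : sin (a + z) = sin a + w * z by rewrite -ew; ring.
clear eu ev ew np nm nz hu hv hw.
have D : 3 / 2 * b <= sin a + u * p - (sin a + v * m) by lra.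
split=> //; first by split; lra.
(* The root offsets and slope errors add up to at most [34 * eta * b], less than [24 * eta] times
   the splitting, which is at least [3 / 2 * b]. *)
have := ler_wpM2l (ltW eta0) D.
set S := sin a + u * p - _ in D *; rewrite -[24 * eta * S]mulrA.
move: (eta * S) => T; lra.
Qed.

End Roots.

(** * The resonant chain *)

Section Phases.
Variable R : realType.
Implicit Types x y z : R.

(** Reflecting the chain about its middle turns a phase [x] into an odd multiple of pi minus [x];
    hence sine waves are symmetric and cosine waves antisymmetric. *)
Lemma sin_reflect k x : sin (pi + pi *+ 2 *+ k - x) = sin x.
Proof.
have := periodicn (@sinD2pi R) k (pi - x).
by rewrite addrAC => ->; rewrite addrC sinDpi sinN opprK.
Qed.

Lemma cos_reflect k x : cos (pi + pi *+ 2 *+ k - x) = - cos x.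
Proof.
have := periodicn (@cosD2pi R) k (pi - x).
by rewrite addrAC => ->; rewrite addrC cosDpi cosN.
Qed.

(** Factoring out the phase of the midpoint [y + z] leaves [- 2 * cos z]; here [2 * z] is the
    deviation from exactly opposite phases. *)
Lemma cis_sub_norm z y : `|cis (y + pi + 2 * z) - cis y| = (2 * `|cos z|)%:C.
Proof.
pose w := y + z.
have -> : y + pi + 2 * z = (w + z) + pi by rewrite /w; ring.
have -> : y = w - z by rewrite /w; ring.
rewrite normc_def /= cosDpi sinDpi cosD cosB sinD sinB.
have -> : (- (cos w * cos z - sin w * sin z) - (cos w * cos z + sin w * sin z)) ^+ 2 +
   (- (sin w * cos z + cos w * sin z) - (sin w * cos z - cos w * sin z)) ^+ 2
   = (2 * cos z) ^+ 2 * (cos w ^+ 2 + sin w ^+ 2) by ring.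
by rewrite cos2Dsin2 mulr1 sqrtr_sqr normrM ger0_norm.
Qed.

Lemma cisD2pi x : cis (x + pi *+ 2) = cis x.
Proof. by rewrite /cis sinD2pi cosD2pi. Qed.

End Phases.

Section ResonantChain.
Variables (R : realType) (n : nat) (a L : R) (k : nat).
Hypothesis n5 : (5 <= n)%N.
Hypothesis nL : n%:R = 2 * L + 3.
Hypothesis res : (pi / 2 - a) * (2 * L) = pi + pi *+ 2 *+ k.
Hypothesis sina : sin a != 0.

Let Q : R := - (2 * sin a)^-1.

(* With theta = pi/2 - (a + psi), the centred waves cos (theta (j - L - 1)) and
   sin (theta (j - L - 1)) are, by [res], up to sign the sine and the cosine of
   this phase; the node 2 of the paper is j = 1. *)
Definition chain_phase (psi : R) (j : nat) : R :=
  psi * L + (pi / 2 - (a + psi)) * (j%:R - 1).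

Lemma chain_phase0 psi : chain_phase psi 0 = psi * L + (a + psi) - pi / 2.
Proof. by rewrite /chain_phase mulr0n; ring. Qed.

Lemma chain_phase1 psi : chain_phase psi 1 = psi * L.
Proof. by rewrite /chain_phase subrr mulr0 addr0. Qed.

Lemma chain_phaseS psi j : chain_phase psi j.+1 = chain_phase psi j + (pi / 2 - (a + psi)).
Proof. by rewrite /chain_phase -natr1; ring. Qed.

(** The phases at mirror-image nodes add up to [(pi / 2 - a) * (2 * L)]: the detuning [psi] cancels,
    and [res] gives the value. *)
Lemma chain_phase_pred1 psi : chain_phase psi n.-1 = pi + pi *+ 2 *+ k - chain_phase psi 0.
Proof.
rewrite chain_phase0 /chain_phase -res (_ : n.-1%:R = 2 * L + 2); first by field.
by have := nL; rewrite -{1}(@prednK n) -?natr1; [lra|lia].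
Qed.

Lemma chain_phase_pred2 psi : chain_phase psi n.-2 = pi + pi *+ 2 *+ k - chain_phase psi 1.
Proof.
rewrite chain_phase1 /chain_phase -res (_ : n.-2%:R = 2 * L + 1); first by field.
have n2 : n = n.-2.+2 by lia.
by have := nL; rewrite {1}n2 -!natr1; lra.
Qed.

Lemma sin_chain_phase_rec psi j : sin (chain_phase psi j) + sin (chain_phase psi j.+2) =
  2 * sin (a + psi) * sin (chain_phase psi j.+1).
Proof.
rewrite chain_phaseS (_ : chain_phase psi j = chain_phase psi j.+1 - (pi / 2 - (a + psi))).
  by rewrite sinB sinD (addrC (pi / 2)) cosDpihalf sinN opprK; ring.
by rewrite chain_phaseS addrK.
Qed.

Lemma cos_chain_phase_rec psi j : cos (chain_phase psi j) + cos (chain_phase psi j.+2) =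
  2 * sin (a + psi) * cos (chain_phase psi j.+1).
Proof.
rewrite chain_phaseS (_ : chain_phase psi j = chain_phase psi j.+1 - (pi / 2 - (a + psi))).
  by rewrite cosB cosD (addrC (pi / 2)) cosDpihalf sinN opprK; ring.
by rewrite chain_phaseS addrK.
Qed.

(** Forced by the eigenvalue equation at the end node; the equation at its neighbour is what
    remains. *)
Definition sym_end (psi : R) : R := sin (psi * L) / (2 * sin (a + psi)).
Definition anti_end (psi : R) : R := cos (psi * L) / (2 * sin (a + psi)).

Definition sym_state (psi : R) : nat -> R :=
  chain_state n (sym_end psi) (sym_end psi) (fun j => sin (chain_phase psi j)).
Definition anti_state (psi : R) : nat -> R :=
  chain_state n (anti_end psi) (- anti_end psi) (fun j => cos (chain_phase psi j)).

Lemma sym_state_eigen psi : sin (a + psi) != 0 -> sym_char a L psi = 0 ->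
  let x : 'rV[R[i]]_n := \row_j (sym_state psi j)%:C in
  x *m chain_hamiltonian n Q = (2 * sin (a + psi))%:C *: x.
Proof.
move=> s0 ch.
have e : 2 * sin (a + psi) * sym_end psi = sin (psi * L) by rewrite /sym_end; field.
(* The first cosine is the wave continued to the end node; after clearing denominators this equation
   is [sym_char a L psi = 0]. *)
have e' : - cos (psi * L + (a + psi)) - sym_end psi = Q * sin (psi * L).
  apply: (mulfI (_ : 2 * sin a * sin (a + psi) != 0)); first by rewrite !mulf_neq0.
  rewrite /sym_end /Q; move: ch; rewrite /sym_char => ch.
  apply/eqP; rewrite -subr_eq0; apply/eqP.
  rewrite -[RHS]oppr0 -ch; field.
  by rewrite sina s0.
apply: chain_state_eigen => //.
- by move=> j; exact: sin_chain_phase_rec.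
- by rewrite chain_phase1.
- by rewrite chain_phase0 chain_phase1 sinBpihalf.
- by rewrite chain_phase_pred2 sin_reflect chain_phase1.
- by rewrite chain_phase_pred1 chain_phase_pred2 !sin_reflect chain_phase0 chain_phase1 sinBpihalf.
Qed.

Lemma anti_state_eigen psi : sin (a + psi) != 0 -> anti_char a L psi = 0 ->
  let x : 'rV[R[i]]_n := \row_j (anti_state psi j)%:C in
  x *m chain_hamiltonian n Q = (2 * sin (a + psi))%:C *: x.
Proof.
move=> s0 ch.
have e : 2 * sin (a + psi) * anti_end psi = cos (psi * L) by rewrite /anti_end; field.
have e' : sin (psi * L + (a + psi)) - anti_end psi = Q * cos (psi * L).
  apply: (mulfI (_ : 2 * sin a * sin (a + psi) != 0)); first by rewrite !mulf_neq0.
  rewrite /anti_end /Q; move: ch; rewrite /anti_char => ch.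
  apply/eqP; rewrite -subr_eq0; apply/eqP.
  rewrite -ch; field.
  by rewrite sina s0.
apply: chain_state_eigen => //.
- by move=> j; exact: cos_chain_phase_rec.
- by rewrite chain_phase1.
- by rewrite chain_phase0 chain_phase1 cosBpihalf.
- by rewrite chain_phase_pred2 cos_reflect chain_phase1 mulrN e.
- rewrite chain_phase_pred1 chain_phase_pred2 !cos_reflect chain_phase0 chain_phase1 cosBpihalf.
  by rewrite mulrN -e' opprB opprK addrC.
Qed.

End ResonantChain.

Lemma qwalk_chain_eigen (R : realType) (n : nat) (Q t lam : R) (x : 'rV[R[i]]_n) :
  (5 <= n)%N -> x *m chain_hamiltonian n Q = lam%:C *: x ->
  x *m qwalk (chain_hamiltonian n Q) t = cis (t * lam) *: x /\
  qwalk (chain_hamiltonian n Q) t *m x^T = cis (t * lam) *: x^T.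
Proof.
move=> n5 xH; have Hh := chain_hamiltonian_herm Q n5; split.
  exact: qwalk_eigen_row.
apply: qwalk_eigen_col => //.
by rewrite -{1}chain_hamiltonian_sym -trmx_mul xH linearZ.
Qed.

Lemma sqnorm_bulk_le (R : realType) (n : nat) (f l : 'I_n) (x : 'I_n -> R) (M : R) :
  (forall j, j != f -> j != l -> `|x j| <= M) -> 0 <= M ->
  sqnorm (fun j => if (j == f) || (j == l) then 0 else (x j)%:C) <= (n%:R * M ^+ 2)%:C.
Proof.
move=> xM M0; rewrite /sqnorm.
apply: (@le_trans _ _ (\sum_(j < n) (M ^+ 2)%:C)).
  apply: ler_sum => j _; case: ifPn => [_|].
    by rewrite normr0 expr0n /= lecR sqr_ge0.
  rewrite negb_or => /andP[jf jl].
  rewrite normc_def /= expr0n addr0 sqrtr_sqr -rmorphXn lecR.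
  by apply: sqr_le_of_abs_le; rewrite normr_id; exact: xM.
by rewrite sumr_const card_ord -rmorphMn -mulr_natl.
Qed.

(** * Lower bounds on the amplitudes at the ends *)

Section EndAmplitudes.
Variables (R : realType) (a L eta b : R).
Hypothesis weak : weak_coupling a L eta b.

Lemma sin_detuned_bounds psi : `|psi| <= 2 * b -> 0 < sin (a + psi) <= 2 * a.
Proof.
have [[a0 _ _] /andP[eta0 eta_small] _ _ _] := weak.
move=> h; have [h1 _] := psi_bounds weak h.
have [_ [u hu ->] _ _ _] := trig_slopes weak h.
have ea : 4 * eta * a <= 4 / 100 * a by rewrite ler_pM2r //; lra.
move: h1; rewrite ler_norml => h1.
apply/andP; split; first by apply: mulr_gt0; lra.
apply: (@le_trans _ _ (1 * (a + psi))); last lra.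
by apply: ler_wpM2r; lra.
Qed.

(** The two symmetric levels have end amplitudes of opposite sign, so these reinforce each other in
    the difference of the eigenvectors. *)
Lemma sym_end_ge s psi : `|psi| <= 2 * b -> 0 < s * psi ->
  s * psi * L / (8 * a) <= s * sym_end a L psi.
Proof.
have [[a0 L0 _] /andP[eta0 eta_small] _ _ _] := weak.
move=> h s0; have := sin_detuned_bounds h.
rewrite /sym_end; have [_ _ _ [v hv ->] _] := trig_slopes weak h.
set S := sin _ => hS; have sL : 0 < s * psi * L by rewrite mulr_gt0.
have -> : s * (v * (psi * L) / (2 * S)) = s * psi * L * (v / (2 * S)) by ring.
rewrite ler_pM2l // ler_pdivlMr; last lra.
rewrite mulrC ler_pdivrMr; last lra.
rewrite mulrA; apply: (@le_trans _ _ (4 * a)); first lra.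
by rewrite ler_pM2r //; lra.
Qed.

Lemma anti_end_ge psi : `|psi| <= 2 * b -> 1 / (8 * a) <= anti_end a L psi.
Proof.
have [[a0 L0 _] /andP[eta0 eta_small] _ _ _] := weak.
move=> h; have := sin_detuned_bounds h.
rewrite /anti_end; have [_ _ _ _ [_ hc]] := trig_slopes weak h.
set S := sin _ => hS; set c := cos _ in hc *.
rewrite ler_pdivlMr; last lra.
rewrite mulrAC ler_pdivrMr; last lra.
rewrite [leRHS]mulrA; apply: (@le_trans _ _ (4 * a)); first lra.
by rewrite ler_pM2r //; lra.
Qed.

End EndAmplitudes.

(** * Fidelity at the transfer time *)

Section ResonantTransfer.
Variables (R : realType) (n k : nat) (a L eta b : R).

Lemma chain_state_first (c0 c1 : R) F : chain_state n c0 c1 F 0 = c0.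
Proof. by []. Qed.

Lemma chain_state_last (c0 c1 : R) F : (1 < n)%N -> chain_state n c0 c1 F n.-1 = c1.
Proof. by move=> n1; rewrite /chain_state eqxx ifF //; lia. Qed.

Lemma chain_state_bulk (c0 c1 : R) F j : j != 0 -> j != n.-1 -> chain_state n c0 c1 F j = F j.
Proof. by move=> j0 j1; rewrite /chain_state (negbTE j0) (negbTE j1). Qed.

(** The two sine waves nearly cancel in the bulk: their phases differ by [p - m] times the distance
    to the middle, at most [(p - m) * L], which the end amplitude exceeds by a factor of order
    [1 / a]. *)
Lemma sym_state_bulk_le (p m c : R) (j : nat) :
  0 < a -> 0 < L -> n%:R = 2 * L + 3 -> (j < n)%N -> j != 0 -> j != n.-1 -> m < p -> 0 < c ->
  (p - m) * L / (8 * a) <= c ->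
  `|(sym_state n a L p j - sym_state n a L m j) / c| <= 8 * a.
Proof.
move=> a0 L0 nL jn j0 j1 mp c0 hc.
rewrite /sym_state !chain_state_bulk // normrM (@gtr0_norm _ c^-1) ?invr_gt0 //.
rewrite ler_pdivrMr //; apply: le_trans (abs_sin_sub_le _ _) _.
apply: (@le_trans _ _ ((p - m) * L)); last first.
  by move: hc; rewrite ler_pdivrMr ?mulr_gt0 // (mulrC c).
have -> : chain_phase a L p j - chain_phase a L m j = (p - m) * (L - (j%:R - 1)).
  by rewrite /chain_phase; ring.
rewrite normrM gtr0_norm ?subr_gt0 // ler_pM2l ?subr_gt0 //.
have : 1 <= j%:R :> R by rewrite (ler_nat _ 1); lia.
have : j%:R + 1 + 1 <= n%:R :> R by rewrite !natr1 ler_nat; lia.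
rewrite ler_norml; lra.
Qed.

Lemma anti_state_bulk_le (z c : R) (j : nat) :
  0 < a -> j != 0 -> j != n.-1 -> 0 < c -> 1 / (8 * a) <= c ->
  `|anti_state n a L z j / c| <= 8 * a.
Proof.
move=> a0 j0 j1 c0 hc.
rewrite /anti_state chain_state_bulk // normrM (@gtr0_norm _ c^-1) ?invr_gt0 //.
rewrite ler_pdivrMr //; apply: le_trans (cos_max _) _.
by move: hc; rewrite ler_pdivrMr ?mulr_gt0 // (mulrC c).
Qed.

Lemma resonant_transfer (f l : 'I_n) : (5 <= n)%N -> f = 0 :> nat -> l = n.-1 :> nat ->
  n%:R = 2 * L + 3 -> (pi / 2 - a) * (2 * L) = pi + pi *+ 2 *+ k ->
  weak_coupling a L eta b ->
  exists2 t : R, 0 < t <= pi / (3 / 2 * b) &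
    (1 - 1152 * eta ^+ 2 - 128 * (n%:R * a ^+ 2))%:C <=
      `|qwalk (chain_hamiltonian n (- (2 * sin a)^-1)) t f l|.
Proof.
move=> n5 f0 l1 nL res weak.
have n1 : (1 < n)%N by lia.
have fl : f != l by apply/eqP => E; move: l1; rewrite -E f0; lia.
have [[a0 L0 b0] _ _ _ _] := weak.
have [p [m [z [[fp fm fz] [hp hm hz] D Dz]]]] := resonant_roots weak.
have [np nm nz] : [/\ `|p| <= 2 * b, `|m| <= 2 * b & `|z| <= 2 * b].
  by split; rewrite ler_norml; lra.
have [sp sm sz] : [/\ sin (a + p) != 0, sin (a + m) != 0 & sin (a + z) != 0].
  by split; apply: lt0r_neq0; [case/andP: (sin_detuned_bounds weak np)|
    case/andP: (sin_detuned_bounds weak nm)|case/andP: (sin_detuned_bounds weak nz)].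
have sa : sin a != 0.
  have := @sin_detuned_bounds _ _ _ _ _ weak 0; rewrite normr0 addr0.
  by move=> /(_ ltac:(lra)) /andP[/lt0r_neq0].
have mp : m < p by lra.
have cs_ge : (p - m) * L / (8 * a) <= sym_end a L p - sym_end a L m.
  have := @sym_end_ge _ _ _ _ _ weak 1 p np; have := @sym_end_ge _ _ _ _ _ weak (-1) m nm.
  rewrite !mul1r !mulN1r => /(_ ltac:(lra)) em /(_ ltac:(lra)) ep.
  have -> : (p - m) * L / (8 * a) = p * L / (8 * a) + - m * L / (8 * a) by ring.
  exact: lerD.
have ca_ge := anti_end_ge weak nz.
have D0 : 0 < sin (a + p) - sin (a + m) by lra.
have a8 : 0 < 8 * a by lra.
have cs0 : 0 < sym_end a L p - sym_end a L m.
  by apply: lt_le_trans cs_ge; rewrite divr_gt0 // mulr_gt0 // subr_gt0.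
have ca0 : 0 < anti_end a L z by apply: lt_le_trans ca_ge; rewrite divr_gt0.
move: cs_ge ca_ge cs0 ca0; set cs := _ - sym_end _ _ _; set ca := anti_end _ _ _ => cs_ge ca_ge cs0 ca0.
(* Energies are twice the sines, so at this time the two symmetric phases differ by a full turn and
   any combination of the two states is an eigenvector of [U]. *)
pose t := pi / (sin (a + p) - sin (a + m)).
have pi0 := @pi_gt0 R.
exists t.
  rewrite divr_gt0 //= ler_pM2l // lef_pV2 ?posrE //; lra.
set U := qwalk _ t.
have [XpU UXp] := qwalk_chain_eigen t n5 (sym_state_eigen n5 nL res sa sp fp).
have [XmU UXm] := qwalk_chain_eigen t n5 (sym_state_eigen n5 nL res sa sm fm).
have [XzU UXz] := qwalk_chain_eigen t n5 (anti_state_eigen n5 nL res sa sz fz).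
rewrite -/U in XpU UXp XmU UXm XzU UXz.
pose mus := cis (t * (2 * sin (a + p))); pose mua := cis (t * (2 * sin (a + z))).
have mus_m : cis (t * (2 * sin (a + m))) = mus.
  rewrite -cisD2pi /mus; congr cis; rewrite /t; field; exact: lt0r_neq0.
rewrite -/mus in XpU UXp; rewrite mus_m in XmU UXm; rewrite -/mua in XzU UXz.
pose xs (j : 'I_n) := (sym_state n a L p j - sym_state n a L m j) / cs.
pose xa (j : 'I_n) := anti_state n a L z j / ca.
pose X : 'rV[R[i]]_n := \row_j (xs j)%:C.
pose A : 'rV[R[i]]_n := \row_j (xa j)%:C.
have XE : X = (cs^-1)%:C *: ((\row_j (sym_state n a L p j)%:C) - \row_j (sym_state n a L m j)%:C).
  by apply/rowP => j; rewrite !mxE -rmorphB -rmorphM mulrC.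
have AE : A = (ca^-1)%:C *: (\row_j (anti_state n a L z j)%:C).
  by apply/rowP => j; rewrite !mxE -rmorphM mulrC.
have XU : X *m U = mus *: X.
  by rewrite XE -scalemxAl mulmxBl XpU XmU -scalerBr !scalerA mulrC.
have UX : U *m X^T = mus *: X^T.
  by rewrite XE linearZ linearB /= -scalemxAr mulmxBr UXp UXm -scalerBr !scalerA mulrC.
have AU : A *m U = mua *: A by rewrite AE -scalemxAl XzU !scalerA mulrC.
have UA : U *m A^T = mua *: A^T by rewrite AE linearZ /= -scalemxAr UXz !scalerA mulrC.
have Xf : X 0 f = 1.
  by rewrite mxE /xs f0 /sym_state !chain_state_first divff ?lt0r_neq0.
have Xl : X 0 l = 1.
  by rewrite mxE /xs l1 /sym_state !chain_state_last // divff ?lt0r_neq0.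
have Af : A 0 f = 1.
  by rewrite mxE /xa f0 /anti_state !chain_state_first divff ?lt0r_neq0.
have Al : A 0 l = -1.
  by rewrite mxE /xa l1 /anti_state !chain_state_last // mulNr divff ?lt0r_neq0 // rmorphN1.
have U_form := qwalk_form_le t (chain_hamiltonian_herm (- (2 * sin a)^-1) n5).
have := transfer_lower_bound fl (cis_norm _) (cis_norm _) XU UX AU UA Xf Xl Af Al U_form.
apply: le_trans.
have jE (j : 'I_n) : j != f -> j != l -> (j != 0 :> nat) * (j != n.-1 :> nat).
  by rewrite -f0 -l1.
have bulk_le (x : 'I_n -> R) : (forall j, j != f -> j != l -> `|x j| <= 8 * a) ->
    sqnorm ((\row_j (if (j == f) || (j == l) then 0 else (\row_i (x i)%:C) 0 j)) 0) <=
    (n%:R * (8 * a) ^+ 2)%:C.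
  move=> xM; have := sqnorm_bulk_le xM (ltW a8); congr (_ <= _).
  by apply: eq_bigr => j _; rewrite !mxE.
have bX := bulk_le xs (fun j jf jl => sym_state_bulk_le a0 L0 nL (ltn_ord j)
  (jE j jf jl).1 (jE j jf jl).2 mp cs0 cs_ge).
have bA := bulk_le xa (fun j jf jl => anti_state_bulk_le z a0
  (jE j jf jl).1 (jE j jf jl).2 ca0 ca_ge).
(* The phases of [mus] and [mua] differ by [pi + 2 * zeta]. With pi at most 4, the constant 24 of
   [resonant_roots] gives 48, and [48 ^+ 2 / 2] is 1152. *)
pose zeta := pi * (sin (a + p) + sin (a + m) - 2 * sin (a + z)) / (2 * (sin (a + p) - sin (a + m))).
have mu_diff : `|mus - mua| = (2 * `|cos zeta|)%:C.
  rewrite -(cis_sub_norm _ (t * (2 * sin (a + z)))); congr (`|cis _ - _|).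
  by rewrite /t /zeta; field; exact: lt0r_neq0.
have zeta_le : `|zeta| <= 48 * eta.
  have /andP[_ pi4] := pi_bounds R.
  rewrite /zeta normrM normfV (@gtr0_norm _ (2 * _)); last by rewrite mulr_gt0.
  rewrite ler_pdivrMr ?mulr_gt0 // normrM gtr0_norm //.
  apply: (@le_trans _ _ (4 * (24 * eta * (sin (a + p) - sin (a + m))))).
    by apply: ler_pM => //; exact: ltW.
  rewrite le_eqVlt; apply/orP; left; apply/eqP; ring.
have cos_zeta : 1 - 1152 * eta ^+ 2 <= `|cos zeta|.
  apply: le_trans (ler_norm _); apply: le_trans (cos_ge_quadratic zeta).
  have := sqr_le_of_abs_le zeta_le.
  have -> : (48 * eta) ^+ 2 = 2 * (1152 * eta ^+ 2) by ring.
  by clear; lra.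
rewrite mu_diff rmorphM /= rmorph_nat mulrAC divff ?pnatr_eq0 // mul1r.
(* The 128 is two bulk norms, each at most [n * (8 * a) ^+ 2]. *)
have -> : (1 - 1152 * eta ^+ 2 - 128 * (n%:R * a ^+ 2))%:C =
    (1 - 1152 * eta ^+ 2)%:C - ((n%:R * (8 * a) ^+ 2)%:C + (n%:R * (8 * a) ^+ 2)%:C) :> R[i].
  by rewrite -rmorphD -rmorphB /=; congr (_%:C); ring.
by apply: lerB; [rewrite lecR|apply: lerD].
Qed.

End ResonantTransfer.

(** * Choice of the parameters *)

Lemma residue_split (n m : nat) : (0 < m)%N -> (100 * m <= n)%N ->
  exists r k, (r < 4)%N /\ n = (5 + r + 4 * m + 4 * k)%N.
Proof. by move=> m0 mn; exists ((n - 5) %% 4)%N, ((n - 5) %/ 4 - m)%N; split; lia. Qed.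

(** Resonance forces [a * L] to lie in a lattice of step pi shifted by the residue of the length
    modulo 4, so a point of order [T] exists as soon as [T] is at least one. *)
Lemma exists_resonance (R : realType) (n : nat) (T : R) : 1 <= T -> 100 * T <= n%:R ->
  exists a k, let L := (n%:R - 3) / 2 in
  (pi / 2 - a) * (2 * L) = pi + pi *+ 2 *+ k /\ T <= a * L <= 8 * T.
Proof.
move=> T1 Tn.
pose m := Num.truncn T.
have T0 : 0 <= T by lra.
have /andP[m_le m_gt] := truncn_itv T0.
rewrite -/m -(natr1 m) in m_gt; rewrite -/m in m_le; clearbody m.
have m1 : (0 < m)%N by rewrite -(ltr0n R); lra.
have mn : (100 * m <= n)%N by rewrite -(ler_nat R) natrM; lra.
have [r [k [r4 nE]]] := residue_split m1 mn.
have L0 : 0 < (n%:R - 3) / 2 :> R by lra.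
(* Subtracting [r + 4 * m] from [2 * L] leaves [2 + 4 * k], and [pi / 2] times this is the required
   odd multiple of pi. *)
exists (pi * (r + 4 * m)%:R / (4 * ((n%:R - 3) / 2))), k => L.
have L_n0 : L != 0 by exact: lt0r_neq0.
split.
  have -> : pi *+ 2 *+ k = pi * (2 * k%:R) :> R by rewrite -(mulr_natr _ k) mulr2n; ring.
  have LE : 2 * L = 2 + r%:R + 4 * m%:R + 4 * k%:R.
    by rewrite /L {1}nE !natrD; field.
  rewrite -/L.
  have -> : (pi / 2 - pi * (r + 4 * m)%:R / (4 * L)) * (2 * L) =
      pi / 2 * (2 * L) - pi * (r + 4 * m)%:R / 2 by field.
  by rewrite LE natrD natrM; field.
rewrite -/L.
have -> : pi * (r + 4 * m)%:R / (4 * L) * L = pi * ((r + 4 * m)%:R / 4) by field.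
have q_bd : m%:R <= ((r + 4 * m)%:R / 4 : R) <= m%:R + 1.
  have -> : (r + 4 * m)%:R = r%:R + 4 * m%:R :> R by rewrite natrD natrM.
  have : r%:R <= 4 :> R by rewrite (ler_nat _ r 4) ltnW.
  have : 0 <= r%:R :> R by [].
  lra.
have m1R : 1 <= m%:R :> R by rewrite (ler_nat _ 1).
set q := _ / 4 in q_bd *.
have /andP[pi2 pi4] := pi_bounds R.
have /andP[q_ge q_le] := q_bd.
have : 2 * m%:R <= pi * q by apply: ler_pM.
have : pi * q <= 4 * (m%:R + 1) by apply: ler_pM => //; [exact: le_trans pi2|exact: le_trans q_ge].
lra.
Qed.

Section Scaling.
Variables (R : realType) (a L eta b : R).
Hypothesis weak : weak_coupling a L eta b.

Lemma potential_bound : `|- (2 * sin a)^-1| <= a^-1.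
Proof.
have [[a0 _ b0] /andP[_ eta_small] _ _ _] := weak.
have x0 : `|0 : R| <= 2 * b by rewrite normr0; lra.
have [[u /andP[hu _] ->] _ _ _ _] := trig_slopes weak x0.
have u2 : a <= 2 * (u * a) by rewrite mulrA ler_peMl ?(ltW a0) //; lra.
rewrite normrN normfV gtr0_norm; last by lra.
by rewrite lef_pV2 ?posrE //; lra.
Qed.

(** Since [b] is [a * sqrt (2 / L)], it is at least [a / s]. The lemma is used with [s] the square
    root of [n]. *)
Lemma time_bound (s : R) : 0 < s -> 2 * L <= s ^+ 2 -> pi / (3 / 2 * b) < 3 * s * a^-1.
Proof.
have [[a0 L0 b0] _ _ _ bL] := weak.
move=> s0 sL.
have b_ge : a <= b * s.
  apply: le_of_sqr_le; first by rewrite mulr_ge0 // ltW.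
  rewrite -(ler_pM2r L0).
  have -> : (b * s) ^+ 2 * L = b ^+ 2 * L * s ^+ 2 by ring.
  have -> : b ^+ 2 * L * s ^+ 2 = a ^+ 2 * (2 * s ^+ 2) by rewrite bL; ring.
  by rewrite ler_pM2l ?exprn_gt0 //; lra.
rewrite ltr_pdivrMr; last lra.
have /andP[_ pi4] := pi_bounds R.
have -> : 3 * s / a * (3 / 2 * b) = 9 / 2 * (b * s / a) by field; exact: lt0r_neq0.
have : 1 <= b * s / a by rewrite ler_pdivlMr // mul1r.
lra.
Qed.

End Scaling.

Lemma exists_weak_coupling (R : realType) (eps : R) (n : nat) :
  0 < eps <= 1 -> (20 * 100) ^+ 2 / eps <= n%:R ->
  exists a eta b k, let L := (n%:R - 3) / 2 in
  [/\ weak_coupling a L eta b, (pi / 2 - a) * (2 * L) = pi + pi *+ 2 *+ k,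
      eta ^+ 2 = eps / 100 / 100, n%:R <= 3 * L &
      a^-1 <= 10 * 100 * Num.sqrt n%:R / eps].
Proof.
move=> /andP[eps0 eps1] n_large.
have n0 : 0 < n%:R :> R.
  by apply: lt_le_trans n_large; rewrite divr_gt0 // exprn_gt0 // mulr_gt0.
pose se := Num.sqrt eps; pose sn := Num.sqrt (n%:R : R).
have se0 : 0 < se by rewrite sqrtr_gt0.
have sn0 : 0 < sn by rewrite sqrtr_gt0.
have se2 : se ^+ 2 = eps by rewrite sqr_sqrtr // ltW.
have sn2 : sn ^+ 2 = n%:R by rewrite sqr_sqrtr // ltW.
have se1 : se <= 1 by apply: le_of_sqr_le => //; rewrite se2 expr1n.
have eps_se : eps <= se by rewrite -se2 expr2 ler_piMr // ltW.
have se_sn : se * sn <= sn by rewrite ler_piMl // ltW.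
have S_ge : 20 * 100 <= se * sn.
  apply: le_of_sqr_le; first by rewrite ltW // mulr_gt0.
  by rewrite [leRHS]exprMn se2 sn2 (mulrC eps) -ler_pdivrMr.
have S_le : se * sn <= n%:R.
  rewrite -sn2 expr2 ler_pM2r //; apply: (le_trans se1).
  by apply: le_trans (le_trans S_ge se_sn); lra.
(* This makes [a] of order [sqrt (eps / n)]; the lower bound on [n] is exactly what gives
   [1 <= T]. *)
pose T := se * sn / 20 / 100.
have T1 : 1 <= T by rewrite /T; lra.
have Tn : 100 * T <= n%:R by rewrite /T; lra.
have [a [k [res /andP[aL_ge aL_le]]]] := exists_resonance T1 Tn.
have nL3 : n%:R <= 3 * ((n%:R - 3) / 2) :> R by lra.
have L0 : 0 < (n%:R - 3) / 2 :> R by lra.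
move: res aL_ge aL_le nL3 L0; set L := (_ - 3) / 2 => res aL_ge aL_le nL3 L0.
have {T1}T0 : 0 < T by exact: lt_le_trans T1.
move: {Tn S_ge S_le se_sn} n_large => n_large.
have a0 : 0 < a by rewrite -(pmulr_lgt0 _ L0); exact: lt_le_trans aL_ge.
(* The third witness solves [b ^+ 2 * L = 2 * a ^+ 2]. *)
exists a, (se / 100), (a * Num.sqrt (2 / L)), k.
have eta2 : (se / 100) ^+ 2 = eps / 100 / 100 by rewrite -se2; field.
have L20 : 0 < 2 / L by rewrite divr_gt0.
have eps_L : eps * n%:R <= eps * (3 * L) by rewrite ler_pM2l.
have eL0 : 0 < eps * L by rewrite mulr_gt0.
split=> //.
  split=> //.
  - by split=> //; rewrite mulr_gt0 // sqrtr_gt0.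
  - by rewrite divr_gt0 //= ler_pM2r ?invr_gt0.
  - rewrite -(ler_pM2r L0).
    have -> : a ^+ 2 * L * L = (a * L) ^+ 2 by ring.
    apply: (@le_trans _ _ ((8 * T) ^+ 2)).
      by apply: sqr_le_of_abs_le; rewrite gtr0_norm // mulr_gt0.
    have -> : (8 * T) ^+ 2 = 4 / 25 / 100 / 100 * (se ^+ 2 * sn ^+ 2).
      by rewrite /T; field.
    rewrite se2 sn2 eta2.
    have -> : eps / 100 / 100 * L = eps * L / 100 / 100 by ring.
    move: eps_L eL0; set x := eps * n%:R; have -> : eps * (3 * L) = 3 * (eps * L) by ring.
    move: (eps * L) => y; clear; lra.
  - rewrite eta2; move: n_large; rewrite ler_pdivrMr // (mulrC _ eps).
    move: eps_L eL0; set x := eps * n%:R; have -> : eps * (3 * L) = 3 * (eps * L) by ring.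
    have -> : eps / 100 / 100 * L = eps * L / 100 / 100 by ring.
    move: (eps * L) => y; clear; lra.
  - by rewrite exprMn sqr_sqrtr ?(ltW L20) //; field; exact: lt0r_neq0.
rewrite -[leLHS]mul1r ler_pdivrMr // -(ler_pM2r L0) mul1r.
apply: (@le_trans _ _ (10 * 100 * sn / eps * T)); last first.
  by rewrite -[leRHS]mulrA ler_pM2l // divr_gt0 // !mulr_gt0.
have -> : 10 * 100 * sn / eps * T = se / eps * (sn ^+ 2 / 2) by rewrite /T; field; exact: lt0r_neq0.
apply: (@le_trans _ _ (sn ^+ 2 / 2)).
  by rewrite sn2 /L ler_pM2r ?invr_gt0 // gerBl.
by rewrite ler_peMl ?divr_ge0 ?sqr_ge0 // ler_pdivlMr // mul1r.
Qed.

Lemma chain_state_transfer (R : realType) (eps : R) (n : nat) (f l : 'I_n) :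
  (5 <= n)%N -> f = 0 :> nat -> l = n.-1 :> nat ->
  0 < eps <= 1 -> (20 * 100) ^+ 2 / eps <= n%:R ->
  exists Q t0 : R,
    [/\ `|Q| <= 10 * 100 * Num.sqrt n%:R / eps,
        0 < t0 < 30 * 100 * n%:R / eps &
        (1 - eps)%:C < `|qwalk (chain_hamiltonian n Q) t0 f l|].
Proof.
move=> n5 f0 l1 epsP n_large.
have [a [eta [b [k [weak res eta2 nL3 a_inv]]]]] := exists_weak_coupling epsP n_large.
have [eps0 eps1] := andP epsP.
have [[a0 L0 b0] _ aL2 _ _] := weak.
move: weak res nL3 L0 aL2; set L := (_ - 3) / 2 => weak res nL3 L0 aL2.
have nL : n%:R = 2 * L + 3 by rewrite /L; field.
have [t /andP[t0 t_le] fid] := resonant_transfer n5 f0 l1 nL res weak.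
have n0 : 0 < n%:R :> R by rewrite ltr0n; exact: leq_trans n5.
exists (- (2 * sin a)^-1), t; split.
- exact: le_trans (potential_bound weak) a_inv.
- rewrite t0 /=; apply: le_lt_trans t_le _.
  have sn0 : 0 < Num.sqrt n%:R :> R by rewrite sqrtr_gt0.
  have sn2 : Num.sqrt n%:R ^+ 2 = n%:R :> R by rewrite sqr_sqrtr // ltW.
  apply: lt_le_trans (time_bound weak sn0 _) _.
    by rewrite sn2 nL lerDl.
  apply: (@le_trans _ _ (3 * Num.sqrt n%:R * (10 * 100 * Num.sqrt n%:R / eps))).
    by apply: ler_wpM2l a_inv; rewrite mulr_ge0 // ltW.
  by rewrite le_eqVlt; apply/orP; left; apply/eqP; rewrite -[in RHS]sn2; ring.
(* With [eta ^+ 2] equal to [eps / 10000] and [n * a ^+ 2] at most [3 * eta ^+ 2], the loss is at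
   most [(1152 + 384) * eps / 10000]. *)
- apply: lt_le_trans fid; rewrite ltcR.
  have : n%:R * a ^+ 2 <= 3 * (a ^+ 2 * L).
    by rewrite (mulrC _ L) [leRHS]mulrA ler_pM2r // exprn_gt0.
  move: aL2; rewrite eta2; set x := n%:R * _; set y := a ^+ 2 * L.
  clear - eps0; move: eps0; lra.
Qed.

Theorem theorem1p2 (R : realType) :
  exists C1 C2 C3 : R, [/\ 0 < C1, 0 < C2, 0 < C3 &
    forall (eps : R) (n : nat) (hn : (4 <= n)%N),
      0 < eps -> C1 / eps <= n%:R ->
      exists Q t0 : R,
        [/\ `|Q| <= C2 * Num.sqrt n%:R / eps,
            0 < t0 < C3 * n%:R / eps &
            (1 - eps)%:C <
              `|qwalk (chain_hamiltonian n Q) t0 (first_node hn) (last_node hn)|]].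
Proof.
exists ((20 * 100) ^+ 2), (10 * 100), (30 * 100).
split; rewrite ?exprn_gt0 ?mulr_gt0 // => eps n hn eps0 n_large.
have n0 : 0 < n%:R :> R by rewrite ltr0n; exact: leq_trans hn.
have [eps1|eps1] := lerP eps 1.
  have n5 : (5 <= n)%N.
    rewrite -(ler_nat R); apply: le_trans n_large; rewrite ler_pdivlMr //.
    apply: (@le_trans _ _ (5 * 1)); first by rewrite ler_pM2l.
    by clear; lra.
  apply: chain_state_transfer => //; last by rewrite eps0.
  by rewrite /= subn1.
(* For [eps] above one the required fidelity is negative, so zero potential and half the time bound
   suffice. *)
have T0 : 0 < 30 * 100 * n%:R / eps by rewrite divr_gt0 // !mulr_gt0.
exists 0, (30 * 100 * n%:R / eps / 2); split.
- by rewrite normr0 divr_ge0 ?mulr_ge0 ?sqrtr_ge0 // ltW.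
- by move: T0; set T := _ / eps; clear; lra.
- by apply: (@lt_le_trans _ _ 0) => //; rewrite -[0]/((0 : R)%:C) ltcR subr_lt0.
Qed.
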